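(* Let $k\ge1$ and let $\mu_k$ be an LTI probability measure on $X_k=\{0,1\}^{\{0,\ldots,k\}}$. Then the total entropy attains its minimum over the set of translation invariant probability measures on $\{0,1\}^{\mathbb{Z}}$ with marginal $\mu_k$ on $X_k$, and some minimizer has the form $$\hat\mu=\sum_{i=0}^{2^k}c_i\,\nu_{{\cal C}_i},\qquad c_i\ge0,\quad\sum_{i=0}^{2^k}c_i=1,$$ for some cycles ${\cal C}_0,\ldots,{\cal C}_{2^k}$ of the de Bruijn graph $G_k$.
   Context: Total entropy of a translation invariant measure $\mu$: $S(\mu)=\lim_{j\to\infty}S(\pi_j\mu)$, where $\pi_j\mu$ is the marginal on coordinates $0,\ldots,j$ and $S$ is the Gibbs–Shannon entropy. LTI: for all $A,A'\subset\{0,\ldots,k\}$ with $A'$ a translate of $A$, the marginal on $\{0,1\}^{A'}$ is the translate of the marginal on $\{0,1\}^A$. The de Bruijn graph $G_k$: vertices are binary strings of length $k$, edges are binary strings of length $k+1$, edge $a\theta b$ runs from $a\theta$ to $\theta b$. A cycle is a closed directed path with no repeated vertex (loops included). For a cycle ${\cal C}$ with edges $\eta^{(1)},\ldots,\eta^{(p)}$ in order, $\nu_{\cal C}$ is the measure giving mass $1/p$ to each of the $p$ translates of the periodic configuration obtained by traversing ${\cal C}$ repeatedly and recording the first symbol of each edge. *)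

(* Defs.v *)
From Stdlib Require Import Reals List Arith Bool.
Import ListNotations.
Open Scope R_scope.

Fixpoint words (n : nat) : list (list bool) :=
  match n with
  | O => [nil]
  | S n' => flat_map (fun w => [false :: w; true :: w]) (words n')
  end.

Definition sumw (n : nat) (f : list bool -> R) : R :=
  fold_right Rplus 0 (map f (words n)).

(** A translation invariant probability measure on {0,1}^Z, represented by its
    cylinder probabilities: P w = mu(x_0 ... x_{|w|-1} = w) (= mu(x_n...x_{n+|w|-1} = w)
    for every n, by translation invariance).  By Kolmogorov extension these
    consistent families are exactly the translation invariant probability
    measures on {0,1}^Z. *)
Definition TI (P : list bool -> R) : Prop :=
  P nil = 1 /\
  (forall w, 0 <= P w) /\
  (forall w, P w = P (w ++ [false]) + P (w ++ [true])) /\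
  (forall w, P w = P (false :: w) + P (true :: w)).

Definition xlnx (x : R) : R := if Rle_dec x 0 then 0 else x * ln x.

Definition entropy_marg (P : list bool -> R) (j : nat) : R :=
  - sumw (S j) (fun w => xlnx (P w)).

Inductive ER : Type := Fin (r : R) | PInf.

Definition total_entropy_is (P : list bool -> R) (e : ER) : Prop :=
  match e with
  | Fin r => Un_cv (entropy_marg P) r
  | PInf => cv_infty (entropy_marg P)
  end.

Definition ER_le (a b : ER) : Prop :=
  match a, b with
  | _, PInf => True
  | Fin x, Fin y => x <= y
  | PInf, Fin _ => False
  end.

Definition prob_Xk (k : nat) (q : list bool -> R) : Prop :=
  (forall w, length w = S k -> 0 <= q w) /\ sumw (S k) q = 1.

Definition marg (k : nat) (q : list bool -> R) (A : list nat) (sigma : nat -> bool) : R :=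
  sumw (S k) (fun w =>
    if forallb (fun a => Bool.eqb (nth a w false) (sigma a)) A then q w else 0).

Definition LTI (k : nat) (q : list bool -> R) : Prop :=
  forall (A : list nat) (t : nat) (sigma : nat -> bool),
    (forall a, In a A -> (a + t <= k)%nat) ->
    marg k q (map (fun a => (a + t)%nat) A) (fun i => sigma (i - t)%nat)
    = marg k q A sigma.

Definition has_marginal (k : nat) (P q : list bool -> R) : Prop :=
  forall w, length w = S k -> P w = q w.

(** De Bruijn graph G_k: edge a.theta.b from a.theta to theta.b. *)
Definition db_edge (k : nat) (v v' : list bool) : Prop :=
  length v = k /\ length v' = k /\ tl v = removelast v'.

Definition is_cycle (k : nat) (c : list (list bool)) : Prop :=
  c <> nil /\ NoDup c /\
  forall i, (i < length c)%nat ->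
    db_edge k (nth i c nil) (nth (S i mod length c) c nil).

(** Periodic configuration: first symbol of the n-th edge = first symbol of
    vertex v_{n mod p}. *)
Definition cycle_config (c : list (list bool)) (n : nat) : bool :=
  hd false (nth (n mod length c) c nil).

Fixpoint match_from (x : nat -> bool) (s : nat) (w : list bool) : bool :=
  match w with
  | nil => true
  | b :: w' => Bool.eqb b (x s) && match_from x (S s) w'
  end.

(** nu_C: mass 1/p on each of the p translates of the periodic configuration;
    cylinder probability of word w at position 0. *)
Definition nu (c : list (list bool)) (w : list bool) : R :=
  / INR (length c) *
  INR (length (filter (fun s => match_from (cycle_config c) s w) (seq 0 (length c)))).

(* Main.v *)
Require Import Defs.
From Stdlib Require Import Reals List Arith Bool ZArith Lia Lra Classical.
Import ListNotations.
Open Scope R_scope.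

(** A marginal on words of length k+1 is a circulation on G_k, hence a combination of simple
    cycles (here: simple periodic orbits up to rotation).  On the polytope of such combinations
    with the prescribed marginal the total entropy is concave, so it is minimal at one of the
    finitely many basic points, and these have at most 2^k + 1 cycles because a circulation is
    determined by its 2^k values on words starting with 1 together with its total mass.
    An arbitrary P of finite total entropy e is compared with this minimum at a finite level:
    its marginal on words of length N is itself a combination of simple cycles of G_(N-1), and
    entropy at most e forces those of period above L to have mass at most e / ln L.  The others
    do not overlap as soon as 2L <= N, and cutting each closed walk into cycles of G_k only
    merges atoms, which cannot increase the entropy. *)

(** A measure is only a consistent family of word probabilities, so the proof invokes neither
    ergodic decomposition nor compactness: the minimum exists because there are finitely many
    supports, and a general [P] is examined at one finite word length at a time. The obstacle is
    that the long orbits are controlled in mass, [beta], but neither in number nor in the overlap of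
    their windows. Only estimates blind to the number of atoms apply to them: discarding them costs
    at most [beta], and reinserting them as cycles of [G_k], whose number does not depend on [L],
    costs at most a constant times [sqrt beta]. Coefficients are masses of single points, so that a
    mixture of orbits sharing no window has entropy [sum p_i eta (c_i)], with [p_i] the periods.
    Integral multiplicities matter because merging uses [eta (n x) <= n eta x], which fails for a
    factor [n] strictly between 0 and 1 when [x > 0]. *)

(** * Finite sums over lists *)

Definition sumL {A : Type} (l : list A) (f : A -> R) : R :=
  fold_right Rplus 0 (map f l).

Lemma sumL_cons {A} (a : A) l f : sumL (a :: l) f = f a + sumL l f.
Proof. reflexivity. Qed.

Lemma sumL_app {A} (l l' : list A) f : sumL (l ++ l') f = sumL l f + sumL l' f.
Proof. induction l as [|a l IH]; cbn [app]; [cbn; lra|]. rewrite !sumL_cons, IH. lra. Qed.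

Lemma sumL_ext {A} (l : list A) f g :
  (forall a, In a l -> f a = g a) -> sumL l f = sumL l g.
Proof.
  induction l as [|a l IH]; intros H; [reflexivity|].
  rewrite !sumL_cons, (H a), IH; auto using in_eq, in_cons.
Qed.

Lemma sumL_plus {A} (l : list A) f g :
  sumL l (fun a => f a + g a) = sumL l f + sumL l g.
Proof. induction l as [|a l IH]; [cbn; lra|]. rewrite !sumL_cons, IH. lra. Qed.

Lemma sumL_scal {A} (l : list A) r f :
  sumL l (fun a => r * f a) = r * sumL l f.
Proof. induction l as [|a l IH]; [cbn; lra|]. rewrite !sumL_cons, IH. lra. Qed.

Lemma sumL_zero {A} (l : list A) f : (forall a, In a l -> f a = 0) -> sumL l f = 0.
Proof.
  induction l as [|a l IH]; intros H; [reflexivity|].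
  rewrite sumL_cons, (H a), IH; auto using in_eq, in_cons. lra.
Qed.

Lemma sumL_le {A} (l : list A) f g :
  (forall a, In a l -> f a <= g a) -> sumL l f <= sumL l g.
Proof.
  induction l as [|a l IH]; intros H; [cbn; lra|].
  rewrite !sumL_cons. apply Rplus_le_compat; auto using in_eq, in_cons.
Qed.

Lemma sumL_nonneg {A} (l : list A) f : (forall a, In a l -> 0 <= f a) -> 0 <= sumL l f.
Proof. intros H. rewrite <- (sumL_zero l (fun _ => 0)) by auto. now apply sumL_le. Qed.

Lemma sumL_swap {A B} (l : list A) (l' : list B) f :
  sumL l (fun a => sumL l' (fun b => f a b)) = sumL l' (fun b => sumL l (fun a => f a b)).
Proof.
  induction l as [|a l IH]; [symmetry; now apply sumL_zero|].
  rewrite sumL_cons, IH, <- sumL_plus. reflexivity.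
Qed.

Lemma sumL_map {A B} (h : A -> B) l f : sumL (map h l) f = sumL l (fun a => f (h a)).
Proof. unfold sumL. now rewrite map_map. Qed.

Lemma sumL_ge_term {A} (l : list A) f a :
  (forall b, In b l -> 0 <= f b) -> In a l -> f a <= sumL l f.
Proof.
  induction l as [|b l IH]; intros H Ha; [easy|]. rewrite sumL_cons.
  destruct Ha as [->|Ha].
  - assert (0 <= sumL l f) by (apply sumL_nonneg; auto using in_cons). lra.
  - specialize (IH (fun b Hb => H b (in_cons _ _ _ Hb)) Ha). specialize (H b (in_eq _ _)). lra.
Qed.

Lemma sumL_filter_split {A} (t : A -> bool) (l : list A) f :
  sumL l f = sumL (filter t l) f + sumL (filter (fun a => negb (t a)) l) f.
Proof.
  induction l as [|a l IH]; [cbn; lra|].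
  cbn [filter]. destruct (t a); cbn [negb]; rewrite !sumL_cons, IH; lra.
Qed.

Lemma exists_argmin {A} (l : list A) (f : A -> R) :
  l <> nil -> exists a, In a l /\ forall b, In b l -> f a <= f b.
Proof.
  induction l as [|a l IH]; intros H; [easy|].
  destruct l as [|a' l].
  { exists a. split; [apply in_eq|]. intros b [->|[]]. lra. }
  destruct IH as [m [Hm Hmin]]; [discriminate|].
  destruct (Rle_dec (f a) (f m)) as [Hle|Hgt].
  - exists a. split; [apply in_eq|]. intros b [->|Hb]; [lra|].
    specialize (Hmin b Hb). lra.
  - exists m. split; [now apply in_cons|]. intros b [->|Hb]; [lra|auto].
Qed.

(** * The function [-x ln x] *)

Definition eta (x : R) : R := - xlnx x.

Lemma eta_eq x : 0 <= x -> eta x = - (x * ln x).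
Proof.
  intros H. unfold eta, xlnx. destruct (Rle_dec x 0); [|lra].
  replace x with 0 by lra. lra.
Qed.

Lemma eta_0 : eta 0 = 0.
Proof. rewrite eta_eq; lra. Qed.

Lemma eta_1 : eta 1 = 0.
Proof. rewrite eta_eq, ln_1; lra. Qed.

Lemma ln_le_sub_1 x : 0 < x -> ln x <= x - 1.
Proof.
  intros H. destruct (Req_dec x 1) as [->|Hne]; [rewrite ln_1; lra|].
  left. apply exp_lt_inv. rewrite exp_ln by easy.
  replace x with (1 + (x - 1)) at 1 by lra. apply exp_ineq1. lra.
Qed.

Lemma ln_le_compat x y : 0 < x -> x <= y -> ln x <= ln y.
Proof. intros H [Hlt| ->]; [left; now apply ln_increasing|lra]. Qed.

(* The right-hand side is the tangent line of [eta] at [z]. *)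
Lemma eta_tangent x z : 0 <= x -> 0 < z -> eta x <= - (x * ln z) + z - x.
Proof.
  intros Hx Hz. rewrite eta_eq by easy.
  destruct (Req_dec x 0) as [->|Hne]; [lra|].
  assert (H : ln (z / x) <= z / x - 1).
  { apply ln_le_sub_1. apply Rdiv_lt_0_compat; lra. }
  unfold Rdiv in H. rewrite ln_mult, ln_Rinv in H by (try apply Rinv_0_lt_compat; lra).
  apply (Rmult_le_compat_l x) in H; [|easy].
  replace (x * (z * / x - 1)) with (z - x) in H by (field; lra). lra.
Qed.

Lemma eta_concave a b x y :
  0 <= a -> 0 <= b -> a + b = 1 -> 0 <= x -> 0 <= y ->
  a * eta x + b * eta y <= eta (a * x + b * y).
Proof.
  intros Ha Hb Hab Hx Hy.
  assert (Hax : 0 <= a * x) by now apply Rmult_le_pos.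
  assert (Hby : 0 <= b * y) by now apply Rmult_le_pos.
  destruct (Req_dec (a * x + b * y) 0) as [H0|Hne].
  - assert (Ex : a * eta x = 0).
    { assert (H : a * x = 0) by lra. rewrite eta_eq by easy.
      replace (a * - (x * ln x)) with (- (a * x * ln x)) by ring. rewrite H. ring. }
    assert (Ey : b * eta y = 0).
    { assert (H : b * y = 0) by lra. rewrite eta_eq by easy.
      replace (b * - (y * ln y)) with (- (b * y * ln y)) by ring. rewrite H. ring. }
    rewrite Ex, Ey, H0, eta_0. lra.
  - set (z := a * x + b * y) in *. assert (Hz : 0 < z) by (unfold z in *; lra).
    pose proof (Rmult_le_compat_l _ _ _ Ha (eta_tangent x z Hx Hz)) as H1.
    pose proof (Rmult_le_compat_l _ _ _ Hb (eta_tangent y z Hy Hz)) as H2.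
    rewrite (eta_eq z) by lra.
    assert (E : a * (- (x * ln z) + z - x) + b * (- (y * ln z) + z - y)
                = - (z * ln z) + ((a + b) * z - z)) by (unfold z; ring).
    rewrite Hab in E. lra.
Qed.

(** Monotonicity of [ln]: both [ln x] and [ln y] are at most [ln (x + y)]. This is the fact that
    merging two atoms loses entropy. *)
Lemma eta_subadd x y : 0 <= x -> 0 <= y -> eta (x + y) <= eta x + eta y.
Proof.
  intros Hx Hy.
  destruct (Req_dec x 0) as [->|Hx0]; [rewrite eta_0, Rplus_0_l; lra|].
  destruct (Req_dec y 0) as [->|Hy0]; [rewrite eta_0, Rplus_0_r; lra|].
  rewrite !eta_eq by lra.
  assert (H1 : ln x <= ln (x + y)) by (apply ln_le_compat; lra).
  assert (H2 : ln y <= ln (x + y)) by (apply ln_le_compat; lra).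
  apply (Rmult_le_compat_l x) in H1; [|lra].
  apply (Rmult_le_compat_l y) in H2; [|lra]. lra.
Qed.

Lemma eta_sum_subadd {A} (l : list A) f :
  (forall a, In a l -> 0 <= f a) -> eta (sumL l f) <= sumL l (fun a => eta (f a)).
Proof.
  induction l as [|a l IH]; intros H; [cbn; rewrite eta_0; lra|].
  rewrite !sumL_cons. eapply Rle_trans.
  - apply eta_subadd; [apply H, in_eq|apply sumL_nonneg; auto using in_cons].
  - apply Rplus_le_compat_l, IH. auto using in_cons.
Qed.

Lemma eta_INR_mult n x : 0 <= x -> eta (INR n * x) <= INR n * eta x.
Proof.
  intros Hx. induction n as [|n IH]; [rewrite !Rmult_0_l, eta_0; lra|].
  rewrite S_INR.
  replace ((INR n + 1) * x) with (INR n * x + x) by ring.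
  eapply Rle_trans; [apply eta_subadd; auto; apply Rmult_le_pos; auto using pos_INR|]. lra.
Qed.

(** The slope [-ln z - 1] of [eta] is at least [-1] on [(0, 1]]. Hence removing mass [y] from an
    atom raises the entropy by at most [y]. *)
Lemma eta_add_ge x y : 0 <= x -> 0 <= y -> x + y <= 1 -> eta x - y <= eta (x + y).
Proof.
  intros Hx Hy H1.
  destruct (Req_dec (x + y) 0) as [H0|H0].
  { replace x with 0 by lra. replace y with 0 by lra. rewrite Rplus_0_l. lra. }
  pose proof (eta_tangent x (x + y) Hx ltac:(lra)) as H.
  rewrite (eta_eq (x + y)) by lra.
  assert (Hln : ln (x + y) <= 0) by (rewrite <- ln_1; apply ln_le_compat; lra).
  apply (Rmult_le_compat_l y) in Hln; [|easy]. lra.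
Qed.

(** Since [eta] is not monotone, an upper bound on the mass calls for a monotone majorant. It comes
    from [ln (1/s) <= 1/s - 1] at [s = sqrt x]. *)
Lemma eta_le_sqrt x y : 0 <= x -> x <= y -> eta x <= 2 * sqrt y.
Proof.
  intros Hx Hxy. apply Rle_trans with (2 * sqrt x).
  2:{ apply Rmult_le_compat_l; [lra|]. now apply sqrt_le_1_alt. }
  destruct (Req_dec x 0) as [->|Hne]; [rewrite eta_0, sqrt_0; lra|].
  rewrite eta_eq by easy. set (s := sqrt x).
  assert (Hs : 0 < s) by (apply sqrt_lt_R0; lra).
  assert (E : x = s * s) by (symmetry; apply sqrt_sqrt; lra).
  rewrite E, ln_mult by easy.
  pose proof (ln_le_sub_1 (/ s) (Rinv_0_lt_compat _ Hs)) as H.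
  rewrite ln_Rinv in H by easy.
  apply (Rmult_le_compat_l (2 * (s * s))) in H; [|nra].
  replace (2 * (s * s) * (/ s - 1)) with (2 * s - 2 * (s * s)) in H by (field; lra).
  nra.
Qed.

(** * Words and periodic orbits *)

Lemma words_S n f :
  sumL (words (S n)) f = sumL (words n) (fun w => f (false :: w) + f (true :: w)).
Proof.
  cbn [words]. induction (words n) as [|w l IH]; [reflexivity|].
  cbn [flat_map app]. rewrite !sumL_cons, IH. lra.
Qed.

Lemma in_words n w : In w (words n) <-> length w = n.
Proof.
  revert w. induction n as [|n IH]; intros w; cbn [words].
  - split; [intros [<-|[]]; reflexivity|]. destruct w; [left; reflexivity|discriminate].
  - rewrite in_flat_map. split.
    + intros [u [Hu [<-|[<-|[]]]]]; cbn; f_equal; now apply IH.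
    + destruct w as [|b w]; [discriminate|]. intros [= H].
      exists w. split; [now apply IH|]. destruct b; cbn; auto.
Qed.

Lemma NoDup_words n : NoDup (words n).
Proof.
  induction n as [|n IH]; cbn [words]; [repeat constructor; easy|].
  induction IH as [|w l Hw _ IHl]; [constructor|]. cbn [flat_map app].
  assert (Hn : forall b, ~ In (b :: w) (flat_map (fun u => [false :: u; true :: u]) l)).
  { intros b H. apply in_flat_map in H. destruct H as [u [Hu [E|[E|[]]]]];
      inversion E; subst; auto. }
  constructor; [|constructor; auto].
  intros [E|H]; [discriminate|]. now apply (Hn false).
Qed.

Lemma length_words n : length (words n) = Nat.pow 2 n.
Proof.
  induction n as [|n IH]; [reflexivity|]. cbn [words Nat.pow]. rewrite <- IH. clear IH.
  induction (words n) as [|w l IHl]; [reflexivity|].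
  cbn [flat_map app length]. rewrite IHl. lia.
Qed.

Lemma words_snoc n : forall f,
  sumL (words (S n)) f = sumL (words n) (fun w => f (w ++ [false]) + f (w ++ [true])).
Proof.
  induction n as [|n IH]; intros f; [now rewrite words_S|].
  rewrite words_S, IH, words_S.
  apply sumL_ext. intros w _. cbn [app]. lra.
Qed.

Definition right_consistent (F : list bool -> R) : Prop :=
  forall w, F w = F (w ++ [false]) + F (w ++ [true]).

Definition left_consistent (F : list bool -> R) : Prop :=
  forall w, F w = F (false :: w) + F (true :: w).

Lemma sum_words_nil F n : right_consistent F -> sumL (words n) F = F nil.
Proof.
  intros H. induction n as [|n IH]; [cbn; lra|].
  rewrite words_snoc, <- IH. apply sumL_ext. intros w _. symmetry. apply H.
Qed.

Lemma right_consistent_agree F G n :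
  right_consistent F -> right_consistent G ->
  (forall w, length w = n -> F w = G w) ->
  forall w, (length w <= n)%nat -> F w = G w.
Proof.
  intros HF HG Hn w Hw. remember (n - length w)%nat as d eqn:Hd.
  revert w Hw Hd. induction d as [|d IH]; intros w Hw Hd; [apply Hn; lia|].
  rewrite HF, HG, !IH; rewrite ?length_app; cbn; auto; lia.
Qed.

Definition word_eq_dec : forall u w : list bool, {u = w} + {u <> w} :=
  list_eq_dec bool_dec.

Definition delta (u w : list bool) : R := if word_eq_dec u w then 1 else 0.

Lemma delta_same u : delta u u = 1.
Proof. unfold delta. now destruct (word_eq_dec u u). Qed.

Lemma delta_ne u w : u <> w -> delta u w = 0.
Proof. unfold delta. now destruct (word_eq_dec u w). Qed.

Lemma delta_range u w : 0 <= delta u w <= 1.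
Proof. unfold delta. destruct (word_eq_dec u w); lra. Qed.

Lemma delta_cons b u c w : delta (b :: u) (c :: w) = if Bool.eqb b c then delta u w else 0.
Proof.
  unfold delta. destruct (Bool.eqb_spec b c) as [->|Hne].
  - destruct (word_eq_dec (c :: u) (c :: w)) as [E|E], (word_eq_dec u w) as [E'|E'];
      congruence.
  - destruct (word_eq_dec (b :: u) (c :: w)) as [E|E]; congruence.
Qed.

Lemma delta_snoc b u c w :
  delta (u ++ [b]) (w ++ [c]) = if Bool.eqb b c then delta u w else 0.
Proof.
  unfold delta. destruct (Bool.eqb_spec b c) as [->|Hne].
  - destruct (word_eq_dec (u ++ [c]) (w ++ [c])) as [E|E], (word_eq_dec u w) as [E'|E'];
      try reflexivity; exfalso.
    + apply app_inj_tail in E. tauto.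
    + apply E. now rewrite E'.
  - destruct (word_eq_dec (u ++ [b]) (w ++ [c])) as [E|E]; [|reflexivity].
    apply app_inj_tail in E. tauto.
Qed.

Lemma sum_delta l u f : NoDup l -> In u l -> sumL l (fun w => delta u w * f w) = f u.
Proof.
  induction 1 as [|w l Hw Hl IH]; intros Hu; [easy|]. rewrite sumL_cons.
  destruct (word_eq_dec u w) as [->|Hne].
  - rewrite delta_same, sumL_zero; [lra|]. intros v Hv.
    rewrite delta_ne; [lra|]. intros ->. easy.
  - rewrite delta_ne, IH by (trivial; destruct Hu; congruence). lra.
Qed.

Definition win (x : nat -> bool) (s n : nat) : list bool := map x (seq s n).

Lemma win_length x s n : length (win x s n) = n.
Proof. unfold win. now rewrite length_map, length_seq. Qed.

Lemma win_S_l x s n : win x s (S n) = x s :: win x (S s) n.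
Proof. reflexivity. Qed.

Lemma win_S_r x s n : win x s (S n) = win x s n ++ [x (s + n)%nat].
Proof. unfold win. now rewrite seq_S, map_app. Qed.

Lemma win_ext x s y t n :
  (forall i, (i < n)%nat -> x (s + i)%nat = y (t + i)%nat) -> win x s n = win y t n.
Proof.
  revert s t. induction n as [|n IH]; intros s t H; [reflexivity|].
  rewrite !win_S_l. f_equal.
  - specialize (H 0%nat ltac:(lia)). now rewrite !Nat.add_0_r in H.
  - apply IH. intros i Hi. specialize (H (S i) ltac:(lia)).
    now rewrite <- !plus_n_Sm in H.
Qed.

Lemma win_inv x s y t n i :
  win x s n = win y t n -> (i < n)%nat -> x (s + i)%nat = y (t + i)%nat.
Proof.
  revert s t i. induction n as [|n IH]; intros s t i H Hi; [lia|].
  rewrite !win_S_l in H. injection H as H0 H.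
  destruct i as [|i]; [now rewrite !Nat.add_0_r|].
  rewrite <- !plus_n_Sm. apply (IH (S s) (S t)); auto. lia.
Qed.

Lemma win_le x s y t n m : (m <= n)%nat -> win x s n = win y t n -> win x s m = win y t m.
Proof. intros Hm H. apply win_ext. intros i Hi. apply (win_inv _ _ _ _ n); auto. lia. Qed.

(** A period together with a configuration, recorded at nonnegative times. The stored period need
    not be minimal; minimality comes with [simple]. *)
Definition orbit : Type := (nat * (nat -> bool))%type.

Definition periodic (o : orbit) : Prop :=
  (0 < fst o)%nat /\ forall s, snd o (s + fst o)%nat = snd o s.

Lemma win_periodic o s n : periodic o -> win (snd o) (s + fst o) n = win (snd o) s n.
Proof.
  intros [_ H]. apply win_ext. intros i _.
  replace (s + fst o + i)%nat with (s + i + fst o)%nat by lia. apply H.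
Qed.

Lemma periodic_mul o s j : periodic o -> snd o (s + j * fst o)%nat = snd o s.
Proof.
  intros [_ H]. induction j as [|j IH]; [f_equal; lia|].
  rewrite <- IH, <- (H (s + j * fst o)%nat). f_equal. lia.
Qed.

Lemma periodic_mod o s : periodic o -> snd o (s mod fst o) = snd o s.
Proof.
  intros H. rewrite <- (periodic_mul o (s mod fst o) (s / fst o) H).
  f_equal. destruct H as [H _]. pose proof (Nat.div_mod_eq s (fst o)). lia.
Qed.

Lemma win_mod o s n : periodic o -> win (snd o) (s mod fst o) n = win (snd o) s n.
Proof.
  intros H. apply win_ext. intros i _.
  rewrite <- (periodic_mul o (s mod fst o + i) (s / fst o) H).
  f_equal. destruct H as [H _]. pose proof (Nat.div_mod_eq s (fst o)). lia.
Qed.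

Lemma sum_shift p (f : nat -> R) t :
  (forall s, f (s + p)%nat = f s) -> sumL (seq t p) f = sumL (seq 0 p) f.
Proof.
  intros H. induction t as [|t IH]; [reflexivity|]. rewrite <- IH.
  enough (sumL (seq t (S p)) f = sumL (seq t p) f + f t) as E.
  { cbn [seq] in E. rewrite sumL_cons in E. lra. }
  rewrite seq_S, sumL_app, sumL_cons, H. cbn. lra.
Qed.

(* [cnt o] is [fst o] times the measure [nu] of the orbit, so a coefficient of [cnt o] is the
   mass of each single point of the orbit. *)
Definition cnt (o : orbit) (w : list bool) : R :=
  sumL (seq 0 (fst o)) (fun s => delta (win (snd o) s (length w)) w).

Lemma cnt_nonneg o w : 0 <= cnt o w.
Proof. apply sumL_nonneg. intros s _. apply delta_range. Qed.

Lemma sumL_const {A} (l : list A) r : sumL l (fun _ => r) = INR (length l) * r.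
Proof.
  induction l as [|a l IH]; [cbn; lra|].
  rewrite sumL_cons, IH. cbn [length]. rewrite S_INR. lra.
Qed.

Lemma cnt_nil o : cnt o nil = INR (fst o).
Proof.
  unfold cnt. rewrite (sumL_ext _ _ (fun _ => 1)) by (intros; apply delta_same).
  rewrite sumL_const, length_seq. lra.
Qed.

Lemma cnt_right o : right_consistent (cnt o).
Proof.
  intros w. unfold cnt. rewrite <- sumL_plus. apply sumL_ext. intros s _.
  rewrite !length_app. cbn [length]. rewrite Nat.add_1_r, win_S_r, !delta_snoc.
  destruct (snd o _); cbn; lra.
Qed.

Lemma cnt_left o : periodic o -> left_consistent (cnt o).
Proof.
  intros H w. unfold cnt. rewrite <- sumL_plus.
  rewrite <- (sum_shift (fst o) _ 1).
  2:{ intros s. now rewrite win_periodic. }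
  rewrite <- seq_shift, sumL_map. apply sumL_ext. intros s _.
  cbn [length]. rewrite win_S_l, !delta_cons. destruct (snd o s); cbn; lra.
Qed.

Lemma cnt_pos_inv o w :
  cnt o w <> 0 -> exists s, (s < fst o)%nat /\ win (snd o) s (length w) = w.
Proof.
  intros H. apply NNPP. intros Hn. apply H. apply sumL_zero. intros s Hs.
  apply delta_ne. intros E. apply Hn. exists s. apply in_seq in Hs. split; [lia|easy].
Qed.

Lemma cnt_win_pos o s n : periodic o -> 0 < cnt o (win (snd o) s n).
Proof.
  intros H. apply Rlt_le_trans with 1; [lra|].
  unfold cnt. rewrite win_length, <- (win_mod o s n H).
  erewrite <- (delta_same (win (snd o) (s mod fst o) n)) at 1.
  apply (sumL_ge_term _ (fun t => delta (win (snd o) t n) (win (snd o) (s mod fst o) n))).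
  - intros t _. apply delta_range.
  - apply in_seq. destruct H as [H _]. pose proof (Nat.mod_upper_bound s (fst o)). lia.
Qed.

(** Change of variables: [cnt o] is the image of the counting measure on one period under reading
    windows. *)
Lemma sum_cnt o n f :
  sumL (words n) (fun w => cnt o w * f w) = sumL (seq 0 (fst o)) (fun s => f (win (snd o) s n)).
Proof.
  rewrite (sumL_ext _ _ (fun w => sumL (seq 0 (fst o)) (fun s => delta (win (snd o) s n) w * f w))).
  - rewrite sumL_swap. apply sumL_ext. intros s _.
    apply (sum_delta (words n)); [apply NoDup_words|]. apply in_words, win_length.
  - intros w Hw. apply in_words in Hw. unfold cnt. rewrite Hw, Rmult_comm, <- sumL_scal.
    apply sumL_ext. intros. lra.
Qed.

(* The cycles of [G_m], up to the choice of a starting vertex. *)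
Definition simple (m : nat) (o : orbit) : Prop :=
  periodic o /\
  forall s t, (s < fst o)%nat -> (t < fst o)%nat ->
    win (snd o) s m = win (snd o) t m -> s = t.

(** Windows of length [m] already distinguish the positions within a period, so a word of length at
    least [m] is met at most once. *)
Lemma simple_cnt_01 m o w :
  simple m o -> (m <= length w)%nat -> cnt o w = 0 \/ cnt o w = 1.
Proof.
  intros [Hp Hs] Hm. destruct (Req_dec (cnt o w) 0) as [H|H]; [now left|right].
  apply cnt_pos_inv in H. destruct H as [s [Hlt E]].
  unfold cnt. rewrite (sumL_ext _ _ (fun t => if Nat.eq_dec s t then 1 else 0)).
  - assert (Hin : In s (seq 0 (fst o))) by (apply in_seq; lia).
    pose proof (seq_NoDup (fst o) 0) as Hnd. clear - Hin Hnd.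
    induction Hnd as [|t l Ht Hl IH]; [easy|]. rewrite sumL_cons.
    destruct (Nat.eq_dec s t) as [->|Hne].
    + rewrite sumL_zero; [lra|]. intros u Hu. destruct (Nat.eq_dec t u); congruence.
    + rewrite IH; [lra|]. destruct Hin; congruence.
  - intros t Ht. apply in_seq in Ht. destruct (Nat.eq_dec s t) as [<-|Hne].
    + rewrite E. apply delta_same.
    + apply delta_ne. intros E'. apply Hne. apply Hs; try lia.
      apply win_le with (n := length w); congruence.
Qed.

Lemma simple_cnt_le1 m o w : simple m o -> (m <= length w)%nat -> cnt o w <= 1.
Proof. intros H Hm. destruct (simple_cnt_01 m o w H Hm); lra. Qed.

Lemma simple_period_le m o : simple m o -> (fst o <= Nat.pow 2 m)%nat.
Proof.
  intros [Hp Hs]. rewrite <- length_words.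
  rewrite <- (length_seq (fst o) 0), <- (length_map (fun s => win (snd o) s m)).
  apply NoDup_incl_length.
  - apply NoDup_map_NoDup_ForallPairs; [|apply seq_NoDup].
    intros s t Hin Ht. apply in_seq in Hin, Ht. apply Hs; lia.
  - intros w Hw. apply in_map_iff in Hw. destruct Hw as [s [<- _]].
    apply in_words, win_length.
Qed.

(** A window determines the position modulo the period, so [d] is a positive multiple of [fst o]. In
    particular [fst o] is the least period. *)
Lemma simple_shift_le m o s d :
  simple m o -> (0 < d)%nat -> win (snd o) (s + d) m = win (snd o) s m -> (fst o <= d)%nat.
Proof.
  intros [Hp Hs] Hd E. rewrite <- win_mod, <- (win_mod o s) in E by easy.
  destruct Hp as [Hp _].
  apply Hs in E; try (apply Nat.mod_upper_bound; lia).
  pose proof (Nat.div_mod_eq s (fst o)) as E1.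
  pose proof (Nat.div_mod_eq (s + d) (fst o)) as E2.
  assert (Hd' : (d = fst o * ((s + d) / fst o) - fst o * (s / fst o))%nat) by lia.
  rewrite <- Nat.mul_sub_distr_l in Hd'.
  destruct ((s + d) / fst o - s / fst o)%nat; [lia|]. rewrite Hd'. nia.
Qed.

(** Equality up to rotation; an offset on each side makes the relation symmetric by inspection. *)
Definition equiv (o o' : orbit) : Prop :=
  fst o = fst o' /\
  exists t t', forall s, snd o (t + s)%nat = snd o' (t' + s)%nat.

Lemma equiv_sym o o' : equiv o o' -> equiv o' o.
Proof. intros [Hp [t [t' H]]]. split; [easy|]. exists t', t. easy. Qed.

Lemma equiv_cnt o o' w : periodic o -> periodic o' -> equiv o o' -> cnt o w = cnt o' w.
Proof.
  intros Ho Ho' [Hp [t [t' H]]]. unfold cnt.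
  rewrite <- (sum_shift (fst o) _ t) by (intros; now rewrite win_periodic).
  rewrite <- (sum_shift (fst o') _ t') by (intros; now rewrite win_periodic).
  rewrite <- Hp.
  assert (E : forall a n, seq a n = map (fun i => (a + i)%nat) (seq 0 n)).
  { intros a n. revert a. induction n as [|n IH]; intros a; [reflexivity|].
    cbn [seq map]. rewrite (IH 1%nat), (IH (S a)), map_map. f_equal; [lia|].
    apply map_ext. intros. lia. }
  rewrite (E t), (E t'), !sumL_map. apply sumL_ext. intros s _.
  f_equal. apply win_ext. intros i _. rewrite <- !Nat.add_assoc. apply H.
Qed.

(* The easy half of the Fine-Wilf theorem: agreement on [p + p'] consecutive
   letters propagates, via x_i = x_(i-p) = x_(i-p-p') = x_(i-p'). *)
Lemma simple_separated m o o' w :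
  simple m o -> simple m o' -> (fst o + fst o' <= length w)%nat ->
  cnt o w <> 0 -> cnt o' w <> 0 -> equiv o o'.
Proof.
  intros Ho Ho' Hlen Hc Hc'.
  apply cnt_pos_inv in Hc, Hc'. destruct Hc as [s [_ Es]], Hc' as [s' [_ Es']].
  assert (Ep := proj2 (proj1 Ho)). assert (Ep' := proj2 (proj1 Ho')).
  assert (H : forall i, snd o (s + i)%nat = snd o' (s' + i)%nat).
  { intros i. induction i as [i IH] using (well_founded_induction lt_wf).
    destruct (Nat.lt_ge_cases i (length w)) as [Hi|Hi].
    - apply win_inv with (n := length w); congruence.
    - destruct (proj1 Ho) as [Hpos _], (proj1 Ho') as [Hpos' _].
      transitivity (snd o (s + (i - fst o - fst o')))%nat.
      + transitivity (snd o (s + (i - fst o)))%nat.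
        { rewrite <- (Ep (s + (i - fst o))%nat). f_equal. lia. }
        rewrite !IH by lia. rewrite <- (Ep' (s' + (i - fst o - fst o'))%nat). f_equal. lia.
      + transitivity (snd o (s + (i - fst o')))%nat.
        { rewrite <- (Ep (s + (i - fst o - fst o'))%nat). f_equal. lia. }
        rewrite IH by lia. rewrite <- (Ep' (s' + (i - fst o'))%nat). f_equal. lia. }
  split; [|now exists s, s'].
  (* By [H], the period of each orbit is also a repetition distance in the other, and the period of
     a simple orbit is its least repetition distance. *)
  apply Nat.le_antisymm.
  - apply (simple_shift_le m o s); [easy|apply (proj1 (proj1 Ho'))|].
    apply win_ext. intros i _. rewrite <- Nat.add_assoc, !H.
    rewrite <- (Ep' (s' + i)%nat). f_equal. lia.
  - apply (simple_shift_le m o' s'); [easy|apply (proj1 (proj1 Ho))|].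
    apply win_ext. intros i _. rewrite <- Nat.add_assoc, <- !H.
    rewrite <- (Ep (s + i)%nat). f_equal. lia.
Qed.

(** * Decomposition of circulations into cycles *)

(** One representative per rotation class, so that by [simple_separated] different indices share no
    sufficiently long window. Values of [rep] from [M] on are arbitrary. *)
Definition transversal (m M : nat) (rep : nat -> orbit) : Prop :=
  (forall i, (i < M)%nat -> simple m (rep i)) /\
  (forall i j, (i < M)%nat -> (j < M)%nat -> equiv (rep i) (rep j) -> i = j) /\
  (forall o, simple m o -> exists i, (i < M)%nat /\ equiv o (rep i)).

(** Greedy selection: an element of the list is kept when it satisfies [Q] and is related to none of
    those already kept. *)
Lemma list_transversal {A : Type} (a0 : A) (Q : A -> Prop) (E : A -> A -> Prop) (l : list A) :
  (forall a b, E a b -> E b a) -> (forall a, E a a) ->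
  exists (M : nat) (rep : nat -> A),
    (forall i, (i < M)%nat -> Q (rep i)) /\
    (forall i j, (i < M)%nat -> (j < M)%nat -> E (rep i) (rep j) -> i = j) /\
    (forall a, In a l -> Q a -> exists i, (i < M)%nat /\ E a (rep i)).
Proof.
  intros Esym Erefl. induction l as [|a l (M & rep & H1 & H2 & H3)].
  { exists 0%nat, (fun _ => a0). repeat split; intros; try lia. easy. }
  destruct (classic (Q a /\ ~ exists i, (i < M)%nat /\ E a (rep i))) as [[HQ Hn]|Hn].
  - exists (S M), (fun i => if Nat.eq_dec i M then a else rep i). repeat split.
    + intros i Hi. destruct (Nat.eq_dec i M); [easy|]. apply H1. lia.
    + intros i j Hi Hj. destruct (Nat.eq_dec i M), (Nat.eq_dec j M); intros HE.
      * lia.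
      * destruct Hn. exists j. split; [lia|easy].
      * destruct Hn. exists i. split; [lia|auto].
      * apply H2; auto; lia.
    + intros b [<-|Hb] Qb.
      * exists M. split; [lia|]. destruct (Nat.eq_dec M M); [apply Erefl|easy].
      * destruct (H3 b Hb Qb) as [i [Hi HE]]. exists i. split; [lia|].
        destruct (Nat.eq_dec i M); [lia|easy].
  - exists M, rep. repeat split; auto. intros b [<-|Hb] Qb; [|auto].
    apply NNPP. tauto.
Qed.

Lemma simple_extensional m o x :
  simple m o -> (forall s, x s = snd o s) -> simple m (fst o, x).
Proof.
  intros [[Hp Hper] Hs] Hx.
  assert (E : forall s n, win x s n = win (snd o) s n)
    by (intros; apply win_ext; auto).
  split; [split|]; cbn [fst snd].
  - easy.
  - intros s. rewrite !Hx. apply Hper.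
  - intros s t H1 H2. rewrite !E. auto.
Qed.

(** The period is at most [2^m] and one period determines the orbit, so the periodic extensions of
    the words of length 1 to [2^m] exhaust the candidates. *)
Lemma transversal_exists m : exists M rep, transversal m M rep.
Proof.
  set (l := flat_map (fun p => map (fun u => (p, fun s => nth (s mod p) u false)) (words p))
              (seq 1 (Nat.pow 2 m)) : list orbit).
  destruct (list_transversal (0%nat, fun _ => false) (simple m) equiv l)
    as (M & rep & H1 & H2 & H3).
  { exact equiv_sym. }
  { intros o. split; [easy|]. now exists 0%nat, 0%nat. }
  exists M, rep. split; [easy|split; [easy|]].
  intros o Ho. assert (Hp := proj1 Ho).
  (* The listed candidate for [o]. It agrees with [snd o] pointwise, which is enough for [simple]
     and [equiv]. *)
  set (x := fun s => nth (s mod fst o) (win (snd o) 0 (fst o)) false).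
  assert (Hx : forall s, x s = snd o s).
  { intros s. unfold x. rewrite <- (periodic_mod o s) by easy.
    assert (Hlt : (s mod fst o < fst o)%nat)
      by (apply Nat.mod_upper_bound; destruct Hp; lia).
    unfold win. rewrite nth_indep with (d' := snd o 0%nat)
      by (now rewrite length_map, length_seq).
    rewrite map_nth, seq_nth by easy. reflexivity. }
  destruct (H3 (fst o, x)) as [i [Hi [E1 (t & t' & E2)]]].
  - apply in_flat_map. exists (fst o). split.
    + apply in_seq. pose proof (simple_period_le m o Ho). destruct Hp. lia.
    + apply in_map_iff. exists (win (snd o) 0 (fst o)). split; [reflexivity|].
      apply in_words, win_length.
  - now apply simple_extensional.
  - exists i. split; [easy|]. split; [easy|]. exists t, t'. intros s.
    rewrite <- E2. symmetry. apply Hx.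
Qed.

Lemma pigeonhole {A : Type} (f : nat -> A) (l : list A) :
  (forall i, In (f i) l) -> exists i d, (0 < d)%nat /\ f i = f (i + d)%nat.
Proof.
  intros H. apply NNPP. intros Hn.
  assert (Hle : (length (map f (seq 0 (S (length l)))) <= length l)%nat).
  { apply NoDup_incl_length.
    - apply NoDup_map_NoDup_ForallPairs; [|apply seq_NoDup].
      intros i j _ _ E. destruct (Nat.lt_total i j) as [Hlt|[Heq|Hlt]]; [|easy|].
      + destruct Hn. exists i, (j - i)%nat. split; [lia|].
        now replace (i + (j - i))%nat with j by lia.
      + destruct Hn. exists j, (i - j)%nat. split; [lia|].
        now replace (j + (i - j))%nat with i by lia.
    - intros a Ha. apply in_map_iff in Ha. destruct Ha as [i [<- _]]. apply H. }
  rewrite length_map, length_seq in Hle. lia.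
Qed.

Lemma least_nat (Q : nat -> Prop) :
  (exists n, Q n) -> exists n, Q n /\ forall j, (j < n)%nat -> ~ Q j.
Proof.
  intros [n Hn]. induction n as [n IH] using (well_founded_induction lt_wf).
  destruct (classic (exists j, (j < n)%nat /\ Q j)) as [[j [Hj HQ]]|H].
  - now apply (IH j).
  - exists n. split; [easy|]. intros j Hj HQ. apply H. now exists j.
Qed.

Definition circulation (m : nat) (F : list bool -> R) : Prop :=
  forall v, length v = m ->
    F (false :: v) + F (true :: v) = F (v ++ [false]) + F (v ++ [true]).

(* Following a fixed choice of outgoing positive edge, the walk is deterministic,
   so its first recurrence closes a simple cycle. *)
Lemma positive_cycle m F w0 :
  (forall w, length w = S m -> 0 <= F w) -> circulation m F ->
  length w0 = S m -> 0 < F w0 ->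
  exists o, simple m o /\ forall s, 0 < F (win (snd o) s (S m)).
Proof.
  intros HF Hc Hw0 Hpos.
  set (nx := fun v => if Rlt_dec 0 (F (v ++ [true])) then true else false).
  set (T := fun v => tl (v ++ [nx v])).
  set (good := fun v => length v = m /\ 0 < F (v ++ [nx v])).
  (* Conservation at [v]: positive inflow forces a positive outgoing edge, and [nx] selects one. *)
  assert (Hgood : forall b v, length v = m -> 0 < F (b :: v) -> good v).
  { intros b v Hv Hb. split; [easy|].
    specialize (Hc v Hv).
    assert (H1 := HF (false :: v) ltac:(cbn; lia)).
    assert (H2 := HF (true :: v) ltac:(cbn; lia)).
    unfold nx. destruct (Rlt_dec 0 (F (v ++ [true]))); [easy|].
    destruct b; lra. }
  set (V := fun i => Nat.iter i T (tl w0)).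
  set (y := fun i => hd false (V i ++ [nx (V i)])).
  assert (Hsplit : forall v, v ++ [nx v] = hd false (v ++ [nx v]) :: T v)
    by (intros [|b v]; reflexivity).
  assert (HT : forall v, good v -> good (T v)).
  { intros v [Hv Hp]. rewrite Hsplit in Hp. eapply Hgood; [|exact Hp].
    pose proof (f_equal (@length bool) (Hsplit v)) as E.
    rewrite length_app in E. cbn in E. lia. }
  assert (HV : forall i, good (V i)).
  { intros i. induction i as [|i IH]; [|now apply HT].
    destruct w0 as [|b v]; [discriminate|]. apply (Hgood b); [|easy].
    cbn in Hw0 |- *. lia. }
  assert (Hstep : forall i, V i ++ [nx (V i)] = y i :: V (S i))
    by (intros i; apply Hsplit).
  assert (Hwin : forall n i, (n <= m)%nat -> firstn n (V i) = win y i n).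
  { intros n. induction n as [|n IH]; intros i Hn; [reflexivity|].
    rewrite win_S_l, <- IH by lia.
    transitivity (firstn (S n) (V i ++ [nx (V i)])).
    - rewrite firstn_app. replace (S n - length (V i))%nat with 0%nat
        by (rewrite (proj1 (HV i)); lia). cbn [firstn]. now rewrite app_nil_r.
    - now rewrite Hstep. }
  assert (HVwin : forall i, V i = win y i m).
  { intros i. rewrite <- Hwin by lia. rewrite <- (proj1 (HV i)). symmetry. apply firstn_all. }
  assert (Hedge : forall i, 0 < F (win y i (S m))).
  { intros i. rewrite win_S_l, <- HVwin, <- Hstep. apply (HV i). }
  (* The distance is minimal over all starting points at once, so a coincidence strictly inside a
     period would contradict it. *)
  destruct (least_nat (fun d => (0 < d)%nat /\ exists i, V i = V (i + d)%nat))
    as (p & [Hp [i Hi]] & Hmin).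
  { destruct (pigeonhole V (words m)) as (i & d & Hd & E).
    - intros i. apply in_words, (HV i).
    - exists d. split; [easy|]. now exists i. }
  assert (Hper : forall s, V (i + s + p)%nat = V (i + s)%nat).
  { intros s. induction s as [|s IH]; [rewrite Nat.add_0_r; easy|].
    replace (i + S s + p)%nat with (S (i + s + p)) by lia.
    replace (i + S s)%nat with (S (i + s)) by lia.
    change (T (V (i + s + p)%nat) = T (V (i + s)%nat)). now rewrite IH. }
  assert (Hwx : forall s n, win (fun s => y (i + s)%nat) s n = win y (i + s) n).
  { intros s n. apply win_ext. intros j _. f_equal. lia. }
  exists (p, fun s => y (i + s)%nat). cbn [fst snd]. split; [split; [split|]|]; cbn [fst snd].
  - easy.
  - intros s. unfold y. rewrite Nat.add_assoc. now rewrite Hper.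
  - assert (Hlt : forall s t, (s < t)%nat -> (t < p)%nat -> V (i + s)%nat <> V (i + t)%nat).
    { intros s t H1 H2 E. apply (Hmin (t - s)%nat); [lia|]. split; [lia|].
      exists (i + s)%nat. rewrite E. f_equal. lia. }
    intros s t Hs Ht. rewrite !Hwx, <- !HVwin. intros E.
    destruct (Nat.lt_total s t) as [H|[H|H]]; [|easy|].
    + now apply Hlt in E.
    + symmetry in E. now apply Hlt in E.
  - intros s. rewrite Hwx. apply Hedge.
Qed.

Lemma cnt_circulation m o : periodic o -> circulation m (cnt o).
Proof. intros H v _. rewrite <- cnt_left, <- cnt_right; auto. Qed.

Lemma sum_kronecker M j r (f : nat -> R) :
  (j < M)%nat ->
  sumL (seq 0 M) (fun i => (if Nat.eq_dec i j then r else 0) * f i) = r * f j.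
Proof.
  intros Hj. assert (Hin : In j (seq 0 M)) by (apply in_seq; lia).
  pose proof (seq_NoDup M 0) as Hnd. clear Hj.
  induction Hnd as [|i l Hi Hl IH]; [easy|]. rewrite sumL_cons.
  destruct (Nat.eq_dec i j) as [->|Hne].
  - rewrite sumL_zero; [lra|]. intros a Ha. destruct (Nat.eq_dec a j); [congruence|lra].
  - rewrite IH; [lra|]. destruct Hin; congruence.
Qed.

Definition combo (M : nat) (rep : nat -> orbit) (c : nat -> R) (w : list bool) : R :=
  sumL (seq 0 M) (fun i => c i * cnt (rep i) w).

(* [Z] is an additive subgroup: taking [Z = R] decomposes real circulations, and taking
   the integers shows that an integral circulation has integral multiplicities. *)
Lemma circulation_decomposition m M rep (Z : R -> Prop) :
  transversal m M rep -> Z 0 ->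
  (forall x y, Z x -> Z y -> Z (x + y)) -> (forall x y, Z x -> Z y -> Z (x - y)) ->
  forall F, (forall w, length w = S m -> 0 <= F w /\ Z (F w)) -> circulation m F ->
  exists c, (forall i, (i < M)%nat -> 0 <= c i /\ Z (c i)) /\
    forall w, length w = S m -> F w = combo M rep c w.
Proof.
  intros (Hr1 & Hr2 & Hr3) Z0 Zp Zm.
  set (pos := fun (F : list bool -> R) w => if Rlt_dec 0 (F w) then true else false).
  set (supp := fun F => filter (pos F) (words (S m))).
  enough (Hind : forall n F, (length (supp F) < n)%nat ->
    (forall w, length w = S m -> 0 <= F w /\ Z (F w)) -> circulation m F ->
    exists c, (forall i, (i < M)%nat -> 0 <= c i /\ Z (c i)) /\
      forall w, length w = S m -> F w = combo M rep c w).
  { intros F. apply (Hind (S (length (supp F)))). lia. }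
  induction n as [|n IH]; intros F Hn HF Hc; [lia|].
  destruct (classic (exists w, length w = S m /\ 0 < F w)) as [[w0 [Hw0 Hpos]]|Hnone].
  2:{ exists (fun _ => 0). split; [intros; split; [lra|easy]|]. intros w Hw. unfold combo.
      rewrite sumL_zero by (intros; lra).
      destruct (HF w Hw) as [H _]. apply Rle_antisym; [|easy].
      apply Rnot_lt_le. intros Hlt. apply Hnone. now exists w. }
  destruct (positive_cycle m F w0) as [o [Ho HFo]]; auto. { intros; now apply HF. }
  assert (Hper := proj1 Ho).
  (* The smallest flow along the cycle is subtracted. The cycle uses each edge at most once, so the
     flow stays nonnegative, and it vanishes on at least one more edge, which drives the induction.
     Being a value of [F], the subtracted amount lies in [Z]. *)
  destruct (exists_argmin (seq 0 (fst o)) (fun s => F (win (snd o) s (S m)))) as [s0 [Hs0 Hmin]].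
  { destruct Hper as [Hp _]. destruct (fst o); [lia|discriminate]. }
  apply in_seq in Hs0.
  set (b := F (win (snd o) s0 (S m))) in *.
  assert (Hb : 0 < b) by apply HFo.
  assert (Zb : Z b) by (apply HF, win_length).
  set (F' := fun w => F w - b * cnt o w).
  assert (H01 : forall w, length w = S m ->
    cnt o w = 0 \/ (cnt o w = 1 /\ b <= F w)).
  { intros w Hw. destruct (simple_cnt_01 m o w Ho ltac:(lia)) as [E|E]; [now left|right].
    split; [easy|]. destruct (cnt_pos_inv o w) as [s [Hs Es]]; [lra|].
    rewrite <- Es, Hw. apply Hmin. apply in_seq. lia. }
  assert (HF' : forall w, length w = S m -> 0 <= F' w /\ Z (F' w)).
  { intros w Hw. destruct (HF w Hw) as [H1 H2]. unfold F'.
    destruct (H01 w Hw) as [E|[E Hle]]; rewrite E.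
    - rewrite Rmult_0_r, Rminus_0_r. easy.
    - rewrite Rmult_1_r. split; [lra|auto]. }
  assert (Hc' : circulation m F').
  { intros v Hv. unfold F'. pose proof (cnt_circulation m o Hper v Hv) as E1.
    pose proof (Hc v Hv) as E2. apply (f_equal (Rmult b)) in E1. lra. }
  destruct (IH F') as [c [Hcc Hcd]]; auto.
  { enough (length (supp F') < length (supp F))%nat by lia.
    apply (NoDup_incl_length (l := win (snd o) s0 (S m) :: supp F')).
    - constructor; [|apply NoDup_filter, NoDup_words].
      intros Hin. apply filter_In in Hin. destruct Hin as [_ Hin]. unfold pos, F' in Hin.
      destruct (H01 (win (snd o) s0 (S m)) (win_length _ _ _)) as [E|[E _]].
      + pose proof (cnt_win_pos o s0 (S m) Hper). lra.
      + rewrite E in Hin. fold b in Hin. destruct (Rlt_dec 0 (b - b * 1)); [lra|discriminate].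
    - intros w [<-|Hin]; apply filter_In; unfold pos.
      + split; [apply in_words, win_length|]. fold b. now destruct (Rlt_dec 0 b).
      + apply filter_In in Hin. destruct Hin as [Hw Hin]. split; [easy|].
        unfold pos, F' in Hin. destruct (Rlt_dec 0 (F w - b * cnt o w)); [|discriminate].
        destruct (Rlt_dec 0 (F w)); [easy|]. apply in_words in Hw.
        pose proof (cnt_nonneg o w). nra. }
  destruct (Hr3 o Ho) as [j [Hj Ej]].
  exists (fun i => c i + if Nat.eq_dec i j then b else 0). split.
  - intros i Hi. destruct (Hcc i Hi) as [H1 H2].
    destruct (Nat.eq_dec i j); (split; [lra|auto]).
  - intros w Hw. unfold combo.
    rewrite (sumL_ext _ _ (fun i => c i * cnt (rep i) w +
       (if Nat.eq_dec i j then b else 0) * cnt (rep i) w)) by (intros; lra).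
    rewrite sumL_plus, sum_kronecker by easy. fold (combo M rep c w).
    rewrite <- Hcd by easy. unfold F'.
    rewrite (equiv_cnt o (rep j) w) by (trivial; now apply Hr1). lra.
Qed.

(** * Entropy minimization over the polytope of cycle mixtures *)

Lemma combo_right M rep c : right_consistent (combo M rep c).
Proof.
  intros w. unfold combo. rewrite <- sumL_plus. apply sumL_ext. intros i _.
  rewrite (cnt_right (rep i) w). lra.
Qed.

Lemma combo_left M rep c :
  (forall i, (i < M)%nat -> periodic (rep i)) -> left_consistent (combo M rep c).
Proof.
  intros H w. unfold combo. rewrite <- sumL_plus. apply sumL_ext. intros i Hi.
  apply in_seq in Hi. rewrite (cnt_left (rep i)) by (apply H; lia). lra.
Qed.

Lemma combo_linear M rep c d t w :
  combo M rep (fun i => c i + t * d i) w = combo M rep c w + t * combo M rep d w.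
Proof.
  unfold combo. rewrite <- sumL_scal, <- sumL_plus. apply sumL_ext. intros. lra.
Qed.

Definition mass (M : nat) (rep : nat -> orbit) (c : nat -> R) : R :=
  sumL (seq 0 M) (fun i => c i * INR (fst (rep i))).

Lemma combo_nil M rep c : combo M rep c nil = mass M rep c.
Proof. apply sumL_ext. intros i _. now rewrite cnt_nil. Qed.

Lemma sum_combo M rep c n : sumL (words n) (combo M rep c) = mass M rep c.
Proof. rewrite sum_words_nil by apply combo_right. apply combo_nil. Qed.

(* Gaussian elimination of one unknown per equation. *)
Lemma linear_dependence n : forall (A : nat -> nat -> R) (l : list nat),
  NoDup l -> (n < length l)%nat ->
  exists d, (exists i, In i l /\ d i <> 0) /\ (forall i, ~ In i l -> d i = 0) /\
    forall r, (r < n)%nat -> sumL l (fun i => d i * A r i) = 0.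
Proof.
  induction n as [|n IH]; intros A l Hnd Hlen.
  { destruct l as [|j l]; [cbn in Hlen; lia|].
    exists (fun i => if Nat.eq_dec i j then 1 else 0). repeat split.
    - exists j. split; [apply in_eq|]. destruct (Nat.eq_dec j j); [lra|easy].
    - intros i Hi. destruct (Nat.eq_dec i j) as [->|]; [|easy]. destruct Hi. apply in_eq.
    - intros; lia. }
  destruct (classic (exists j, In j l /\ A n j <> 0)) as [[j [Hj Hpiv]]|Hzero].
  - apply in_split in Hj. destruct Hj as (l1 & l2 & ->).
    assert (Hj : ~ In j (l1 ++ l2)) by now apply NoDup_remove_2.
    apply NoDup_remove_1 in Hnd. rewrite length_app in Hlen. cbn in Hlen.
    destruct (IH (fun r i => A r i - A r j / A n j * A n i) (l1 ++ l2))
      as (d & (i0 & Hi0 & Hd0) & Hoff & Heq); [easy|rewrite length_app; lia|].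
    (* The value of the pivot unknown [j] that equation [n] forces. *)
    set (t := - (sumL (l1 ++ l2) (fun i => d i * A n i) / A n j)).
    set (d' := fun i => if Nat.eq_dec i j then t else d i).
    assert (Hsum : forall f, sumL (l1 ++ j :: l2) (fun i => d' i * f i)
      = sumL (l1 ++ l2) (fun i => d i * f i) + t * f j).
    { intros f. rewrite <- (sumL_ext (l1 ++ l2) (fun i => d' i * f i)).
      - rewrite !sumL_app, sumL_cons. unfold d' at 2.
        destruct (Nat.eq_dec j j); [lra|easy].
      - intros i Hi. unfold d'. destruct (Nat.eq_dec i j); congruence. }
    exists d'. repeat split.
    + exists i0. split.
      * apply in_app_iff in Hi0. apply in_app_iff. cbn. tauto.
      * unfold d'. destruct (Nat.eq_dec i0 j); congruence.
    + intros i Hi. unfold d'. destruct (Nat.eq_dec i j) as [->|].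
      * destruct Hi. apply in_elt.
      * apply Hoff. intros H. apply Hi. apply in_app_iff in H. apply in_app_iff.
        cbn. tauto.
    + intros r Hr. rewrite (Hsum (A r)).
      destruct (Nat.eq_dec r n) as [->|Hne].
      * unfold t. field. easy.
      * rewrite <- (Heq r) by lia.
        rewrite (sumL_ext _ (fun i => d i * (A r i - A r j / A n j * A n i))
          (fun i => d i * A r i + (- (A r j / A n j)) * (d i * A n i))) by (intros; lra).
        rewrite sumL_plus, sumL_scal. unfold t. field. easy.
  - destruct (IH A l Hnd ltac:(lia)) as (d & H1 & H2 & H3).
    exists d. split; [easy|split; [easy|]]. intros r Hr.
    destruct (Nat.eq_dec r n) as [->|Hne]; [|apply H3; lia].
    apply sumL_zero. intros i Hi.
    assert (E : A n i = 0) by (apply NNPP; intros H; apply Hzero; now exists i).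
    rewrite E. lra.
Qed.

(* The zeros propagate by shifting the leftmost 1 to the front. *)
Lemma circulation_zero k G :
  circulation k G -> (forall v, length v = k -> G (true :: v) = 0) ->
  sumL (words (S k)) G = 0 -> forall w, length w = S k -> G w = 0.
Proof.
  intros Hc H1 Htot.
  assert (Hone : forall j u, length (repeat false j ++ true :: u) = S k ->
    G (repeat false j ++ true :: u) = 0).
  { intros j. induction j as [|j IH]; intros u Hu.
    - apply H1. cbn in Hu. lia.
    - cbn [repeat app] in *. cbn [length] in Hu.
      (* At this vertex the edge entering with a 1 vanishes by [H1] and both leaving edges vanish by
         [IH], hence so does the edge entering with a 0. *)
      assert (Hv := Hc (repeat false j ++ true :: u) ltac:(lia)).
      rewrite H1, <- !app_assoc in Hv by lia. cbn [app] in Hv.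
      rewrite !IH in Hv; [lra| |];
        rewrite length_app in *; cbn [length] in *; rewrite length_app; cbn; lia. }
  assert (Hcase : forall w, (exists j u, w = repeat false j ++ true :: u) \/
    w = repeat false (length w)).
  { induction w as [|b w IH]; [now right|]. destruct b.
    - left. now exists 0%nat, w.
    - destruct IH as [(j & u & E)|E]; [left; exists (S j), u|right]; cbn; now rewrite <- E. }
  (* The all-zero word is the only one left, so its value is the total sum. *)
  assert (Hz : G (repeat false (S k)) = 0).
  { rewrite <- Htot. symmetry.
    rewrite <- (sum_delta (words (S k)) (repeat false (S k)) G).
    - apply sumL_ext. intros w Hw. apply in_words in Hw.
      destruct (word_eq_dec (repeat false (S k)) w) as [<-|Hne].
      + rewrite delta_same. lra.
      + rewrite delta_ne by easy. destruct (Hcase w) as [(j & u & E)|E].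
        * rewrite E, Hone; [lra|]. now rewrite <- E.
        * rewrite Hw in E. congruence.
    - apply NoDup_words.
    - apply in_words, repeat_length. }
  intros w Hw. destruct (Hcase w) as [(j & u & E)|E].
  - rewrite E. apply Hone. now rewrite <- E.
  - rewrite E, Hw. easy.
Qed.

(** The limiting value of the block entropies of a mixture: orbit [i] contributes [fst (rep i)]
    atoms of mass [c i]. *)
Definition entropy_of (M : nat) (rep : nat -> orbit) (c : nat -> R) : R :=
  sumL (seq 0 M) (fun i => INR (fst (rep i)) * eta (c i)).

Definition feasible k M rep (q : list bool -> R) (c : nat -> R) : Prop :=
  (forall i, (i < M)%nat -> 0 <= c i) /\
  forall w, length w = S k -> combo M rep c w = q w.

Definition kernel k M rep (d : nat -> R) : Prop :=
  forall w, length w = S k -> combo M rep d w = 0.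

(** For feasible [c], the algebraic form of being a vertex of the polytope: no nonzero admissible
    direction lives on the support of [c]. *)
Definition basic k M rep (c : nat -> R) : Prop :=
  forall d, kernel k M rep d -> (forall i, (i < M)%nat -> c i = 0 -> d i = 0) ->
  forall i, (i < M)%nat -> d i = 0.

Definition supp (M : nat) (c : nat -> R) : list nat :=
  filter (fun i => if Req_dec_T (c i) 0 then false else true) (seq 0 M).

Lemma in_supp M c i : In i (supp M c) <-> (i < M)%nat /\ c i <> 0.
Proof.
  unfold supp. rewrite filter_In, in_seq.
  destruct (Req_dec_T (c i) 0); split; intros [H1 H2]; split; try easy; lia.
Qed.

Lemma sum_supp M c f :
  (forall i, c i = 0 -> f i = 0) -> sumL (seq 0 M) f = sumL (supp M c) f.
Proof.
  intros H. unfold supp.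
  rewrite (sumL_filter_split (fun i => if Req_dec_T (c i) 0 then false else true)).
  rewrite (sumL_zero (filter (fun a => negb _) _)); [lra|].
  intros i Hi. apply filter_In in Hi. destruct Hi as [_ Hi]. apply H.
  now destruct (Req_dec_T (c i) 0).
Qed.

Section Optimization.
Context (k M : nat) (rep : nat -> orbit) (q : list bool -> R)
  (Hrep : forall i, (i < M)%nat -> periodic (rep i)).

Lemma kernel_mass d : kernel k M rep d -> mass M rep d = 0.
Proof.
  intros H. rewrite <- (sum_combo M rep d (S k)). apply sumL_zero. intros w Hw.
  apply H. now apply in_words.
Qed.

(** The entries of a kernel direction, weighted by the positive periods, sum to zero. So every
    nonzero direction eventually leaves the polytope. *)
Lemma kernel_negative d i :
  kernel k M rep d -> (i < M)%nat -> d i <> 0 -> exists j, (j < M)%nat /\ d j < 0.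
Proof.
  intros Hd Hi Hne. apply NNPP. intros Hn.
  assert (Hpos : forall j, In j (seq 0 M) -> 0 <= d j * INR (fst (rep j))).
  { intros j Hj. apply in_seq in Hj. apply Rmult_le_pos; [|apply pos_INR].
    apply Rnot_lt_le. intros H. apply Hn. exists j. split; [lia|easy]. }
  assert (Hin : In i (seq 0 M)) by (apply in_seq; lia).
  pose proof (sumL_ge_term _ _ _ Hpos Hin) as H. cbv beta in H.
  pose proof (kernel_mass d Hd) as Hm. unfold mass in Hm. rewrite Hm in H.
  assert (0 < INR (fst (rep i))) by (apply lt_0_INR; now apply Hrep).
  assert (Hdi : 0 < d i).
  { destruct (Rtotal_order (d i) 0) as [Hlt|[E|Hgt]]; [|easy|easy].
    destruct Hn. now exists i. }
  nra.
Qed.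

(** The ratio test of the simplex method: [t] is the least [c j / - d j] over the negative entries
    of [d], the moment when a coordinate first reaches zero. No new coordinate appears, because [d]
    vanishes off the support of [c]. *)
Lemma leave_polytope c d :
  feasible k M rep q c -> kernel k M rep d ->
  (forall i, (i < M)%nat -> c i = 0 -> d i = 0) ->
  (exists i, (i < M)%nat /\ d i < 0) ->
  exists t, 0 < t /\ feasible k M rep q (fun i => c i + t * d i) /\
    (length (supp M (fun i => (c i + t * d i)%R)) < length (supp M c))%nat.
Proof.
  intros [Hc Hq] Hd Hsupp [i0 [Hi0 Hneg0]].
  set (l := filter (fun i => if Rlt_dec (d i) 0 then true else false) (seq 0 M)).
  assert (Hl : forall i, In i l <-> (i < M)%nat /\ d i < 0).
  { intros i. unfold l. rewrite filter_In, in_seq.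
    destruct (Rlt_dec (d i) 0); split; intros [H1 H2]; split; try easy; lia. }
  destruct (exists_argmin l (fun i => c i / - d i)) as [j [Hj Hmin]].
  { intros E. assert (H : In i0 l) by now apply Hl. now rewrite E in H. }
  apply Hl in Hj. destruct Hj as [Hj Hdj].
  set (t := c j / - d j).
  assert (Hcj : 0 < c j).
  { destruct (Hc j Hj) as [H|H]; [easy|]. symmetry in H. apply Hsupp in H; [lra|easy]. }
  assert (Ht : 0 < t) by (apply Rdiv_lt_0_compat; lra).
  exists t. split; [easy|]. split; [split|].
  - intros i Hi. destruct (Rlt_dec (d i) 0) as [Hlt|Hge].
    + assert (Hle : t <= c i / - d i) by (apply Hmin; now apply Hl).
      apply (Rmult_le_compat_r (- d i)) in Hle; [|lra].
      replace (c i / - d i * - d i) with (c i) in Hle by (field; lra). lra.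
    + specialize (Hc i Hi). apply Rplus_le_le_0_compat; [easy|].
      apply Rmult_le_pos; lra.
  - intros w Hw. rewrite combo_linear, (Hd w Hw), Hq by easy. lra.
  - apply (NoDup_incl_length (l := j :: supp M (fun i => c i + t * d i))).
    + constructor; [|apply NoDup_filter, seq_NoDup].
      rewrite in_supp. intros [_ H]. apply H. unfold t. field. lra.
    + intros i [<-|Hi].
      * apply in_supp. split; [easy|lra].
      * apply in_supp in Hi. destruct Hi as [Hi Hne]. apply in_supp. split; [easy|].
        intros H0. apply Hne. rewrite H0, (Hsupp i Hi H0). lra.
Qed.

(* Entropy is concave, so it does not increase in at least one of the two directions
   [d], [-d] along which a non-basic point can be moved to a face. *)
Lemma reduce_to_basic c :
  feasible k M rep q c ->
  exists c', feasible k M rep q c' /\ basic k M rep c' /\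
    entropy_of M rep c' <= entropy_of M rep c.
Proof.
  remember (length (supp M c)) as n eqn:Hn. revert c Hn.
  induction n as [n IH] using (well_founded_induction lt_wf). intros c Hn Hc.
  destruct (classic (basic k M rep c)) as [Hb|Hb].
  { exists c. split; [easy|split; [easy|lra]]. }
  assert (Hd : exists d i, kernel k M rep d /\
    (forall i, (i < M)%nat -> c i = 0 -> d i = 0) /\ (i < M)%nat /\ d i <> 0).
  { apply NNPP. intros H. apply Hb. intros d H1 H2 i Hi. apply NNPP. intros H3.
    apply H. now exists d, i. }
  destruct Hd as (d & i & Hd & Hsupp & Hi & Hne).
  assert (Hd' : kernel k M rep (fun i => - d i)).
  { intros w Hw. rewrite <- (Rmult_0_r (-1)), <- (Hd w Hw). unfold combo.
    rewrite <- sumL_scal. apply sumL_ext. intros. lra. }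
  destruct (leave_polytope c d Hc Hd Hsupp) as (t & Ht & Ft & Lt).
  { now apply (kernel_negative d i). }
  destruct (leave_polytope c (fun i => - d i) Hc Hd') as (u & Hu & Fu & Lu).
  { intros j Hj H0. rewrite (Hsupp j Hj H0). lra. }
  { apply (kernel_negative _ i); [easy|easy|lra]. }
  (* The weights that write [c] as a convex combination of the two exit points, since
     [a * t = b * u]. *)
  set (a := u / (t + u)). set (b := t / (t + u)).
  assert (Hab : a + b = 1) by (unfold a, b; field; lra).
  assert (Ha : 0 < a) by (apply Rdiv_lt_0_compat; lra).
  assert (Hb' : 0 < b) by (apply Rdiv_lt_0_compat; lra).
  assert (Hconc : a * entropy_of M rep (fun i => c i + t * d i)
    + b * entropy_of M rep (fun i => c i + u * - d i) <= entropy_of M rep c).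
  { unfold entropy_of. rewrite <- !sumL_scal, <- sumL_plus. apply sumL_le.
    intros j Hj. apply in_seq in Hj.
    pose proof (eta_concave a b (c j + t * d j) (c j + u * - d j)
      ltac:(lra) ltac:(lra) Hab (proj1 Ft j ltac:(lia)) (proj1 Fu j ltac:(lia))) as H.
    replace (a * (c j + t * d j) + b * (c j + u * - d j)) with (c j) in H
      by (unfold a, b; field; lra).
    apply (Rmult_le_compat_l (INR (fst (rep j)))) in H; [|apply pos_INR]. lra. }
  destruct (Rle_dec (entropy_of M rep (fun i => c i + t * d i)) (entropy_of M rep c)).
  - destruct (IH _ ltac:(rewrite Hn; exact Lt) _ eq_refl Ft) as (c' & H1 & H2 & H3).
    exists c'. split; [easy|split; [easy|lra]].
  - destruct (IH _ ltac:(rewrite Hn; exact Lu) _ eq_refl Fu) as (c' & H1 & H2 & H3).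
    exists c'. split; [easy|split; [easy|]].
    eapply Rle_trans; [exact H3|]. nra.
Qed.

(** The difference is a kernel direction on the support of [c], hence zero. So a basic point, and
    with it the entropy, is determined by its support. *)
Lemma basic_unique c c' :
  feasible k M rep q c -> feasible k M rep q c' -> basic k M rep c ->
  (forall i, (i < M)%nat -> c i = 0 -> c' i = 0) -> entropy_of M rep c' = entropy_of M rep c.
Proof.
  intros [_ H] [_ H'] Hb Hs.
  assert (E : forall i, (i < M)%nat -> c' i + -1 * c i = 0).
  { apply Hb.
    - intros w Hw. rewrite combo_linear, H, H' by easy. lra.
    - intros i Hi H0. rewrite (Hs i Hi H0), H0. lra. }
  apply sumL_ext. intros i Hi. apply in_seq in Hi.
  specialize (E i ltac:(lia)). now replace (c' i) with (c i) by lra.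
Qed.

(** A larger support would carry a nonzero [d] satisfying [2^k + 1] homogeneous equations;
    [circulation_zero] puts that [d] in the kernel, against [basic]. Rows [r < 2^k] are the words
    starting with 1, and row [2^k] is the total mass. *)
Lemma basic_supp_le c :
  basic k M rep c -> (length (supp M c) <= S (Nat.pow 2 k))%nat.
Proof.
  intros Hb. apply Nat.nlt_ge. intros Hlt.
  destruct (linear_dependence (S (Nat.pow 2 k))
    (fun r i => if Nat.eq_dec r (Nat.pow 2 k) then INR (fst (rep i))
                else cnt (rep i) (true :: nth r (words k) nil)) (supp M c))
    as (d & (i & Hi & Hne) & Hoff & Heq); [apply NoDup_filter, seq_NoDup|easy|].
  assert (Hd0 : forall j, (j < M)%nat -> c j = 0 -> d j = 0).
  { intros j Hj H0. apply Hoff. rewrite in_supp. tauto. }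
  assert (Hsum : forall f, sumL (supp M c) (fun j => d j * f j)
                           = sumL (seq 0 M) (fun j => d j * f j)).
  { intros f. rewrite (sum_supp M d) by (intros j ->; lra).
    unfold supp at 1. symmetry. rewrite <- (sum_supp M d) by (intros j ->; lra).
    rewrite (sumL_filter_split (fun i => if Req_dec_T (c i) 0 then false else true)).
    rewrite (sumL_zero (filter (fun a => negb _) _)); [lra|].
    intros j Hj. apply filter_In in Hj. destruct Hj as [Hj H0]. apply in_seq in Hj.
    rewrite Hd0; [lra|lia|]. now destruct (Req_dec_T (c j) 0). }
  apply in_supp in Hi. apply Hne, (Hb d); [|easy|easy].
  unfold kernel. apply circulation_zero.
  - intros v _. rewrite <- combo_left, <- combo_right; auto.
  - intros v Hv. apply in_words in Hv. destruct (In_nth _ _ nil Hv) as (r & Hr & Er).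
    rewrite length_words in Hr.
    specialize (Heq r ltac:(lia)).
    destruct (Nat.eq_dec r (Nat.pow 2 k)); [lia|]. rewrite Er in Heq.
    now rewrite Hsum in Heq.
  - rewrite sum_combo. specialize (Heq (Nat.pow 2 k) ltac:(lia)).
    destruct (Nat.eq_dec (Nat.pow 2 k) (Nat.pow 2 k)); [|easy].
    now rewrite Hsum in Heq.
Qed.

(** Elements of [B] carry labels from a finite list and [f] depends on the label alone. The labels
    will be supports, so the basic points themselves need not be enumerated. *)
Lemma minimum_of_finitely_many {A B : Type} (f : B -> R) (Q : A -> B -> Prop) (l : list A) :
  (forall a b b', Q a b -> Q a b' -> f b = f b') ->
  (exists a b, In a l /\ Q a b) ->
  exists a b, In a l /\ Q a b /\ forall a' b', In a' l -> Q a' b' -> f b <= f b'.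
Proof.
  intros Hf. induction l as [|a l IH]; [intros (a & b & [] & _)|]. intros Hex.
  destruct (classic (exists a b, In a l /\ Q a b)) as [H|Hl],
    (classic (exists b, Q a b)) as [[b Hb]|Ha].
  - destruct (IH H) as (a1 & b1 & H1 & H2 & H3).
    destruct (Rle_dec (f b1) (f b)) as [Hle|Hgt].
    + exists a1, b1. split; [now right|split; [easy|]].
      intros a' b' [<-|Hin] Hq; [rewrite (Hf _ _ _ Hq Hb); lra|eauto].
    + exists a, b. split; [now left|split; [easy|]].
      intros a' b' [<-|Hin] Hq; [rewrite (Hf _ _ _ Hq Hb); lra|].
      specialize (H3 _ _ Hin Hq). lra.
  - destruct (IH H) as (a1 & b1 & H1 & H2 & H3).
    exists a1, b1. split; [now right|split; [easy|]].
    intros a' b' [<-|Hin] Hq; [destruct Ha; now exists b'|eauto].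
  - exists a, b. split; [now left|split; [easy|]].
    intros a' b' [<-|Hin] Hq; [rewrite (Hf _ _ _ Hq Hb); lra|].
    destruct Hl. now exists a', b'.
  - exfalso. destruct Hex as (a' & b' & [<-|Hin] & Hq); [apply Ha|apply Hl]; eauto.
Qed.

Lemma entropy_minimizer :
  (exists c, feasible k M rep q c) ->
  exists c, feasible k M rep q c /\ (length (supp M c) <= S (Nat.pow 2 k))%nat /\
    forall c', feasible k M rep q c' -> entropy_of M rep c <= entropy_of M rep c'.
Proof.
  intros [c0 H0].
  (* The support coded as a Boolean word, so that [words M] lists all possible supports. *)
  set (pattern := fun c : nat -> R =>
    map (fun i => if Req_dec_T (c i) 0 then false else true) (seq 0 M)).
  assert (Hpat : forall c c', pattern c = pattern c' ->
    forall i, (i < M)%nat -> c i = 0 -> c' i = 0).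
  { intros c c' E i Hi Hc.
    assert (E' := win_inv (fun i => if Req_dec_T (c i) 0 then false else true) 0
      (fun i => if Req_dec_T (c' i) 0 then false else true) 0 M i E Hi).
    cbn in E'. now destruct (Req_dec_T (c i) 0), (Req_dec_T (c' i) 0). }
  set (Q := fun u c => pattern c = u /\ feasible k M rep q c /\ basic k M rep c).
  assert (Hin : forall c, In (pattern c) (words M)).
  { intros c. apply in_words. unfold pattern. now rewrite length_map, length_seq. }
  destruct (minimum_of_finitely_many (entropy_of M rep) Q (words M)) as (u & c & _ & Hc & Hmin).
  - intros u c c' (E & F & B) (E' & F' & _). symmetry. apply basic_unique; auto.
    apply Hpat. congruence.
  - destruct (reduce_to_basic c0 H0) as (c & F & B & _).
    exists (pattern c), c. split; [apply Hin|]. now split.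
  - exists c. destruct Hc as (_ & F & B). split; [easy|split; [now apply basic_supp_le|]].
    intros c' F'. destruct (reduce_to_basic c' F') as (c1 & F1 & B1 & H1).
    eapply Rle_trans; [|exact H1]. apply (Hmin (pattern c1)); [apply Hin|]. now split.
Qed.
End Optimization.

(** * Comparison of a translation invariant measure with cycle mixtures *)

Lemma sum_eta_cnt m n o r :
  simple m o -> (m <= n)%nat ->
  sumL (words n) (fun w => eta (r * cnt o w)) = INR (fst o) * eta r.
Proof.
  intros Ho Hm. rewrite (sumL_ext _ _ (fun w => cnt o w * eta r)).
  - rewrite sum_cnt, sumL_const, length_seq. reflexivity.
  - intros w Hw. apply in_words in Hw.
    destruct (simple_cnt_01 m o w Ho ltac:(lia)) as [->| ->].
    + rewrite Rmult_0_r, eta_0. lra.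
    + rewrite Rmult_1_r. lra.
Qed.

(** At each word at most one summand is nonzero, and [eta 0 = 0], so [eta] of the sum splits into
    one term per orbit. *)
Lemma sum_eta_disjoint m n (rep : nat -> orbit) (b : nat -> R) (l : list nat) :
  (m <= n)%nat -> NoDup l -> (forall i, In i l -> simple m (rep i)) ->
  (forall i j w, In i l -> In j l -> i <> j -> length w = n ->
     cnt (rep i) w = 0 \/ cnt (rep j) w = 0) ->
  sumL (words n) (fun w => eta (sumL l (fun i => b i * cnt (rep i) w)))
  = sumL l (fun i => INR (fst (rep i)) * eta (b i)).
Proof.
  intros Hm Hnd. induction Hnd as [|i l Hi Hl IH]; intros Hs Hdisj.
  { rewrite sumL_zero; [reflexivity|]. intros. apply eta_0. }
  rewrite sumL_cons, <- IH by auto using in_cons.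
  rewrite <- (sum_eta_cnt m n) by auto using in_eq.
  rewrite <- sumL_plus. apply sumL_ext. intros w Hw. apply in_words in Hw.
  rewrite sumL_cons. destruct (Req_dec (cnt (rep i) w) 0) as [->|Hne].
  - rewrite Rmult_0_r, eta_0, !Rplus_0_l. reflexivity.
  - rewrite (sumL_zero l); [rewrite eta_0, !Rplus_0_r; reflexivity|].
    intros j Hj. destruct (Hdisj i j w) as [H|H]; try easy.
    + apply in_eq.
    + now apply in_cons.
    + congruence.
    + rewrite H. lra.
Qed.

(** Cycles of [G_k] have period at most [2^k], so two different ones share no word of length
    [2 * 2^k]. From that length on the block entropy is constant. *)
Lemma entropy_of_combo k M rep c n :
  transversal k M rep -> (2 * Nat.pow 2 k <= n)%nat ->
  sumL (words n) (fun w => eta (combo M rep c w)) = entropy_of M rep c.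
Proof.
  intros (H1 & H2 & _) Hn.
  pose proof (Nat.pow_gt_lin_r 2 k ltac:(lia)).
  apply (sum_eta_disjoint k); [lia|apply seq_NoDup| |].
  - intros i Hi. apply in_seq in Hi. apply H1. lia.
  - intros i j w Hi Hj Hne Hw. apply in_seq in Hi, Hj.
    apply NNPP. intros H0. apply Hne. apply H2; [lia|lia|].
    assert (Hsi := H1 i ltac:(lia)). assert (Hsj := H1 j ltac:(lia)).
    pose proof (simple_period_le k _ Hsi). pose proof (simple_period_le k _ Hsj).
    apply (simple_separated k _ _ w); [easy|easy|lia| |]; tauto.
Qed.

(* Jensen's inequality for each orbit separately: the [fst (rep i)] windows of the i-th
   orbit are distinct, so their probabilities sum to at most 1. *)
Lemma mean_log_period_le_entropy m n M rep b P :
  (forall i, (i < M)%nat -> simple m (rep i)) -> (m <= n)%nat ->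
  (forall i, (i < M)%nat -> 0 <= b i) ->
  (forall w, length w = n -> P w = combo M rep b w) -> sumL (words n) P = 1 ->
  sumL (seq 0 M) (fun i => b i * INR (fst (rep i)) * ln (INR (fst (rep i))))
  <= sumL (words n) (fun w => eta (P w)).
Proof.
  intros Hs Hm Hb HP Htot.
  assert (Hterm : forall w i, In i (seq 0 M) -> 0 <= b i * cnt (rep i) w).
  { intros w i Hi. apply in_seq in Hi. apply Rmult_le_pos; [apply Hb; lia|apply cnt_nonneg]. }
  assert (Hpos : forall w, length w = n -> 0 <= P w).
  { intros w Hw. rewrite HP by easy. apply sumL_nonneg. apply Hterm. }
  rewrite (sumL_ext (words n) _
    (fun w => sumL (seq 0 M) (fun i => b i * (cnt (rep i) w * - ln (P w))))).
  2:{ intros w Hw. apply in_words in Hw. rewrite eta_eq by auto.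
      replace (- (P w * ln (P w))) with (- ln (P w) * P w) by lra.
      rewrite (HP w Hw) at 2. unfold combo. rewrite <- sumL_scal.
      apply sumL_ext. intros. lra. }
  rewrite sumL_swap. apply sumL_le. intros i Hi. rewrite sumL_scal, sum_cnt.
  assert (Hi' := Hi). apply in_seq in Hi'.
  assert (Hsi := Hs i ltac:(lia)). assert (Hbi := Hb i ltac:(lia)).
  destruct (Req_dec (b i) 0) as [->|Hne]; [lra|].
  rewrite Rmult_assoc. apply Rmult_le_compat_l; [easy|].
  set (o := rep i) in *. set (p := INR (fst o)).
  assert (Hp : 0 < p) by (apply lt_0_INR; apply Hsi).
  assert (Hsum : sumL (seq 0 (fst o)) (fun s => P (win (snd o) s n)) <= 1).
  { rewrite <- sum_cnt, <- Htot. apply sumL_le. intros w Hw. apply in_words in Hw.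
    pose proof (simple_cnt_le1 m o w Hsi ltac:(lia)). specialize (Hpos w Hw).
    apply (Rmult_le_compat_r (P w)) in H; lra. }
  (* The tangent bound [- ln x >= ln p + 1 - p x], exact at the uniform value [x = 1/p]. Summed over
     the [p] windows, the last term takes away at most [p]. *)
  apply Rle_trans with (sumL (seq 0 (fst o))
    (fun s => (ln p + 1) + - p * P (win (snd o) s n))).
  - rewrite sumL_plus, sumL_const, sumL_scal, length_seq. fold p. nra.
  - apply sumL_le. intros s Hin.
    assert (HPs : 0 < P (win (snd o) s n)).
    { rewrite HP by apply win_length.
      apply Rlt_le_trans with (b i * cnt (rep i) (win (snd o) s n)).
      - apply Rmult_lt_0_compat; [lra|]. apply cnt_win_pos, Hsi.
      - unfold combo. apply (sumL_ge_term _ (fun i => b i * cnt (rep i) (win (snd o) s n))); auto. }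
    pose proof (ln_le_sub_1 (p * P (win (snd o) s n))
      (Rmult_lt_0_compat _ _ Hp HPs)) as H.
    rewrite ln_mult in H by easy. lra.
Qed.

Lemma finite_choice {A : Type} (a0 : A) (Q : nat -> A -> Prop) n :
  (forall i, (i < n)%nat -> exists a, Q i a) ->
  exists f, forall i, (i < n)%nat -> Q i (f i).
Proof.
  induction n as [|n IH]; intros H; [exists (fun _ => a0); lia|].
  destruct IH as [f Hf]; [auto|]. destruct (H n ltac:(lia)) as [a Ha].
  exists (fun i => if Nat.eq_dec i n then a else f i). intros i Hi.
  destruct (Nat.eq_dec i n) as [->|]; [easy|]. apply Hf. lia.
Qed.

(* A periodic orbit is a closed walk in [G_k], which splits into cycles of [G_k]. *)
Lemma orbit_decomposition k M rep o :
  transversal k M rep -> periodic o ->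
  exists mu : nat -> nat, forall w, length w = S k ->
    cnt o w = combo M rep (fun j => INR (mu j)) w.
Proof.
  intros Ht Ho.
  destruct (circulation_decomposition k M rep (fun x => exists z, x = IZR z) Ht)
    with (F := cnt o) as (c & Hc & Hd).
  - now exists 0%Z.
  - intros x y [a ->] [b ->]. exists (a + b)%Z. now rewrite plus_IZR.
  - intros x y [a ->] [b ->]. exists (a - b)%Z. now rewrite minus_IZR.
  - intros w _. split; [apply cnt_nonneg|]. unfold cnt.
    induction (seq 0 (fst o)) as [|s l [z IH]]; [now exists 0%Z|].
    rewrite sumL_cons, IH. unfold delta.
    destruct (word_eq_dec (win (snd o) s (length w)) w);
      [exists (1 + z)%Z; rewrite plus_IZR|exists z]; lra.
  - now apply cnt_circulation.
  - destruct (finite_choice 0%nat (fun j n => c j = INR n) M) as [mu Hmu].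
    { intros j Hj. destruct (Hc j Hj) as [H0 [z Hz]]. exists (Z.to_nat z).
      rewrite Hz in *. apply le_IZR in H0. rewrite INR_IZR_INZ, Z2Nat.id; easy. }
    exists mu. intros w Hw. rewrite Hd by easy. apply sumL_ext. intros j Hj.
    apply in_seq in Hj. rewrite Hmu by lia. reflexivity.
Qed.

Lemma TI_sum P n : TI P -> sumL (words n) P = 1.
Proof. intros (H0 & _ & Hr & _). rewrite sum_words_nil; auto. Qed.

Lemma TI_le_1 P w : TI P -> P w <= 1.
Proof.
  intros H. rewrite <- (TI_sum P (length w) H). apply sumL_ge_term.
  - intros u _. apply H.
  - now apply in_words.
Qed.

(* [P] is decomposed at level [m]; orbits of period at most [L] have disjoint windows, so
   splitting them into cycles of [G_k] does not increase their entropy, while by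
   [mean_log_period_le_entropy] the longer ones carry mass [beta <= H / ln L]. *)
Lemma cycle_approximation k M rep P L :
  transversal k M rep -> TI P -> (1 <= L)%nat ->
  let H := sumL (words (S (2 * L + k))) (fun w => eta (P w)) in
  exists c beta, feasible k M rep P c /\ 0 <= beta /\ beta * ln (INR L) <= H /\
    entropy_of M rep c <=
      H + beta + sumL (seq 0 M) (fun j => INR (fst (rep j))) * (2 * sqrt beta).
Proof.
  (* The term [2 * L] separates orbits of period at most [L]; the term [k] makes words of length
     [S k] visible at this level. *)
  intros Ht HTI HL H. set (m := (2 * L + k)%nat) in *.
  assert (HTI' := HTI). destruct HTI' as (_ & Hpos & Hright & Hleft).
  destruct (transversal_exists m) as (M' & rep' & Ht').
  destruct (circulation_decomposition m M' rep' (fun _ => True) Ht') with (F := P)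
    as (b & Hb & Hd); auto.
  { intros v _. now rewrite <- Hleft, <- Hright. }
  assert (Hdw : forall w, (length w <= S m)%nat -> P w = combo M' rep' b w).
  { apply right_consistent_agree; auto. apply combo_right. }
  assert (Hs' := proj1 Ht').
  destruct (finite_choice (fun _ => 0%nat) (fun i mu => forall w, length w = S k ->
    cnt (rep' i) w = combo M rep (fun j => INR (mu j)) w) M') as [mu Hmu].
  { intros i Hi. apply orbit_decomposition; auto. now apply Hs'. }
  set (p' := fun i => INR (fst (rep' i))). set (p := fun j => INR (fst (rep j))).
  assert (Hmass : forall i, (i < M')%nat -> sumL (seq 0 M) (fun j => INR (mu i j) * p j) = p' i).
  { intros i Hi. change (mass M rep (fun j => INR (mu i j)) = p' i).
    rewrite <- (sum_combo M rep (fun j => INR (mu i j)) (S k)).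
    unfold p'. rewrite <- cnt_nil, <- (sum_words_nil _ (S k) (cnt_right (rep' i))).
    apply sumL_ext. intros w Hw. apply in_words in Hw. now rewrite Hmu. }
  set (good := fun i => Nat.leb (fst (rep' i)) L).
  set (lg := filter good (seq 0 M')).
  set (lb := filter (fun i => negb (good i)) (seq 0 M')).
  assert (Hlg : forall i, In i lg -> (i < M')%nat /\ (fst (rep' i) <= L)%nat).
  { intros i Hi. apply filter_In in Hi. destruct Hi as [Hi1 Hi2].
    apply in_seq in Hi1. apply Nat.leb_le in Hi2. split; [lia|easy]. }
  assert (Hlb : forall i, In i lb -> (i < M')%nat /\ (L < fst (rep' i))%nat).
  { intros i Hi. apply filter_In in Hi. destruct Hi as [Hi1 Hi2].
    apply in_seq in Hi1. apply negb_true_iff, Nat.leb_gt in Hi2. split; [lia|easy]. }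
  assert (Hbg : forall i, In i lg -> 0 <= b i) by (intros i Hi; apply Hb; now apply Hlg).
  assert (Hbb : forall i, In i lb -> 0 <= b i) by (intros i Hi; apply Hb; now apply Hlb).
  assert (Hp' : forall i, 0 <= p' i) by (intros; apply pos_INR).
  assert (Hp : forall j, 0 <= p j) by (intros; apply pos_INR).
  set (beta := sumL lb (fun i => b i * p' i)).
  assert (Hbeta : 0 <= beta).
  { apply sumL_nonneg. intros i Hi. apply Rmult_le_pos; auto. }
  (* [x j] and [y j] are the masses per point that cycle [j] receives from the short and from the
     long orbits. *)
  set (x := fun j => sumL lg (fun i => INR (mu i j) * b i)).
  set (y := fun j => sumL lb (fun i => INR (mu i j) * b i)).
  assert (Hx : forall j, 0 <= x j).
  { intros j. apply sumL_nonneg. intros i Hi. apply Rmult_le_pos; auto using pos_INR. }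
  assert (Hy : forall j, 0 <= y j).
  { intros j. apply sumL_nonneg. intros i Hi. apply Rmult_le_pos; auto using pos_INR. }
  assert (HLpos : 0 < INR L) by (apply lt_0_INR; lia).
  assert (HlnL : 0 <= ln (INR L)).
  { rewrite <- ln_1. apply ln_le_compat; [lra|]. apply (le_INR 1). lia. }
  exists (fun j => x j + y j), beta. repeat split.
  - intros j _. apply Rplus_le_le_0_compat; auto.
  - intros w Hw. rewrite Hdw by lia. unfold combo.
    rewrite (sumL_ext (seq 0 M') _
      (fun i => sumL (seq 0 M) (fun j => INR (mu i j) * b i * cnt (rep j) w))).
    2:{ intros i Hi. apply in_seq in Hi. rewrite Hmu by (trivial; lia). unfold combo.
        rewrite <- sumL_scal. apply sumL_ext. intros. lra. }
    rewrite sumL_swap. apply sumL_ext. intros j _. unfold x, y.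
    rewrite (sumL_filter_split good (seq 0 M')). fold lg lb.
    rewrite Rmult_plus_distr_r, !(Rmult_comm (sumL _ _) (cnt _ _)), <- !sumL_scal.
    f_equal; apply sumL_ext; intros; lra.
  - exact Hbeta.
  - apply Rle_trans with
      (sumL (seq 0 M') (fun i => b i * p' i * ln (p' i))).
    2:{ apply (mean_log_period_le_entropy m (S m) M' rep' b P); auto.
        - intros i Hi. now apply Hb.
        - now apply TI_sum. }
    rewrite (sumL_filter_split good (seq 0 M')). fold lg lb.
    assert (Hg : 0 <= sumL lg (fun i => b i * p' i * ln (p' i))).
    { apply sumL_nonneg. intros i Hi. apply Rmult_le_pos; [apply Rmult_le_pos; auto|].
      rewrite <- ln_1. apply ln_le_compat; [lra|]. apply (le_INR 1).
      apply (Hs' i). now apply Hlg. }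
    enough (beta * ln (INR L) <= sumL lb (fun i => b i * p' i * ln (p' i))) by lra.
    unfold beta. rewrite Rmult_comm, <- sumL_scal. apply sumL_le. intros i Hi.
    rewrite Rmult_comm. apply Rmult_le_compat_l; [apply Rmult_le_pos; auto|].
    apply ln_le_compat; [easy|]. apply le_INR. apply Hlb in Hi. lia.
  (* Subadditivity bounds [eta (x j)] by the [eta (b i)] with multiplicity, and [Hmass] reassembles
     the periods. What results is the block entropy of the short part of [P], which exceeds [H] by
     at most [beta] thanks to [eta_add_ge]. *)
  - assert (Hxx : sumL (seq 0 M) (fun j => p j * eta (x j)) <= H + beta).
    { apply Rle_trans with (sumL lg (fun i => p' i * eta (b i))).
      - apply Rle_trans with
          (sumL (seq 0 M) (fun j => sumL lg (fun i => INR (mu i j) * p j * eta (b i)))).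
        + apply sumL_le. intros j _.
          rewrite (sumL_ext lg _ (fun i => p j * (INR (mu i j) * eta (b i))))
            by (intros; lra).
          rewrite sumL_scal. apply Rmult_le_compat_l; [auto|].
          unfold x. eapply Rle_trans; [apply eta_sum_subadd|].
          * intros i Hi. apply Rmult_le_pos; auto using pos_INR.
          * apply sumL_le. intros i Hi. apply eta_INR_mult. auto.
        + rewrite sumL_swap. right. apply sumL_ext. intros i Hi.
          rewrite (sumL_ext _ _ (fun j => eta (b i) * (INR (mu i j) * p j))) by (intros; lra).
          rewrite sumL_scal, Hmass by now apply Hlg. lra.
      - unfold p'. rewrite <- (sum_eta_disjoint m (S m)).
        + assert (EB : beta =
            sumL (words (S m)) (fun w => sumL lb (fun i => b i * cnt (rep' i) w))).
          { rewrite sumL_swap. apply sumL_ext. intros i _.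
            rewrite sumL_scal, (sum_words_nil _ _ (cnt_right (rep' i))), cnt_nil. reflexivity. }
          rewrite EB. unfold H. rewrite <- sumL_plus. apply sumL_le. intros w Hw.
          apply in_words in Hw.
          assert (E : P w = sumL lg (fun i => b i * cnt (rep' i) w)
                          + sumL lb (fun i => b i * cnt (rep' i) w)).
          { rewrite Hd by easy. apply sumL_filter_split. }
          assert (H1 := TI_le_1 P w HTI). rewrite E in H1 |- *.
          apply eta_add_ge in H1; [lra| |]; apply sumL_nonneg; intros i Hi;
            apply Rmult_le_pos; auto using cnt_nonneg.
        + lia.
        + apply NoDup_filter, seq_NoDup.
        + intros i Hi. now apply Hs', Hlg.
        + intros i j w Hi Hj Hne Hw. apply Hlg in Hi, Hj. apply NNPP. intros H0. apply Hne.
          apply (proj1 (proj2 Ht')); try easy.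
          apply (simple_separated m _ _ w); [now apply Hs'|now apply Hs'|lia| |]; tauto. }
    (* Each [y j] is at most [beta]: cycle [j] has at least one point, and all its points lie in the
       mass of the long orbits. *)
    assert (Hyy : sumL (seq 0 M) (fun j => p j * eta (y j)) <=
      sumL (seq 0 M) p * (2 * sqrt beta)).
    { rewrite Rmult_comm, <- sumL_scal. apply sumL_le. intros j Hj.
      rewrite Rmult_comm. apply Rmult_le_compat_r; [auto|]. apply eta_le_sqrt; [auto|].
      assert (Hpj : 1 <= p j).
      { apply (le_INR 1). apply in_seq in Hj. apply (proj1 Ht j). lia. }
      apply Rle_trans with (p j * y j); [specialize (Hy j); nra|].
      unfold y, beta. rewrite <- sumL_scal. apply sumL_le. intros i Hi.
      replace (p j * (INR (mu i j) * b i)) with (b i * (INR (mu i j) * p j)) by lra.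
      apply Rmult_le_compat_l; [auto|]. rewrite <- Hmass by now apply Hlb.
      apply (sumL_ge_term _ (fun j => INR (mu i j) * p j)); [|easy].
      intros. apply Rmult_le_pos; auto using pos_INR. }
    fold p. apply Rle_trans with (sumL (seq 0 M) (fun j => p j * eta (x j))
      + sumL (seq 0 M) (fun j => p j * eta (y j))); [|lra].
    rewrite <- sumL_plus. apply sumL_le. intros j _. fold (p j).
    rewrite <- Rmult_plus_distr_l. apply Rmult_le_compat_l; [auto|]. now apply eta_subadd.
Qed.

(** The constant [K] depends only on the cycles of [G_k], so letting [L] grow makes [beta], and with
    it the whole error, as small as desired. *)
Lemma cycle_lower_bound k M rep P s e :
  transversal k M rep -> TI P ->
  (forall c, feasible k M rep P c -> s <= entropy_of M rep c) ->
  (forall n, sumL (words n) (fun w => eta (P w)) <= e) -> s <= e.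
Proof.
  intros Ht HTI Hs He. apply Rnot_lt_le. intros Hlt.
  set (K := sumL (seq 0 M) (fun j => INR (fst (rep j)))).
  assert (HK : 0 <= K) by (apply sumL_nonneg; intros; apply pos_INR).
  assert (He0 : 0 <= e).
  { specialize (He 0%nat). cbn in He. rewrite (proj1 HTI), eta_1 in He. lra. }
  (* Once [beta <= r * r <= r], the error [beta + 2 K sqrt beta] is at most [r (1 + 2 K)], that is,
     at most half of the gap [s - e]. *)
  set (r := Rmin 1 ((s - e) / (2 * (1 + 2 * K)))).
  assert (Hr : 0 < r).
  { apply Rmin_glb_lt; [lra|]. apply Rdiv_lt_0_compat; lra. }
  assert (Hr1 : r <= 1) by apply Rmin_l.
  assert (Hrs : r * (1 + 2 * K) <= (s - e) / 2).
  { assert (H : r <= (s - e) / (2 * (1 + 2 * K))) by apply Rmin_r.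
    apply (Rmult_le_compat_r (1 + 2 * K)) in H; [|lra].
    replace ((s - e) / (2 * (1 + 2 * K)) * (1 + 2 * K)) with ((s - e) / 2) in H
      by (field; lra). exact H. }
  (* If [ln L >= t] and [beta > r * r], then [beta * ln L] would be at least [e + 1], above the
     entropy bound [e]. *)
  set (t := (e + 1) / (r * r)).
  destruct (INR_unbounded (exp t)) as [L HL].
  assert (HL1 : (1 <= L)%nat).
  { destruct L; [|lia]. cbn in HL. pose proof (exp_pos t). lra. }
  assert (Hln : t <= ln (INR L)).
  { rewrite <- (ln_exp t). apply ln_le_compat; [apply exp_pos|lra]. }
  destruct (cycle_approximation k M rep P L Ht HTI HL1) as (c & beta & Hc & Hb & Hb1 & Hb2).
  fold K in Hb2. specialize (Hs c Hc). specialize (He (S (2 * L + k))).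
  assert (Hbr : beta <= r * r).
  { apply Rnot_lt_le. intros Hgt.
    assert (Ht1 : r * r * t = e + 1) by (unfold t; field; lra).
    assert (Htp : 0 < t) by (apply Rdiv_lt_0_compat; nra).
    nra. }
  assert (Hsq : sqrt beta <= r).
  { rewrite <- (sqrt_square r) by lra. now apply sqrt_le_1_alt. }
  assert (HKs : K * (2 * sqrt beta) <= K * (2 * r)) by (apply Rmult_le_compat_l; lra).
  nra.
Qed.

(** * Locally translation invariant marginals and cycles of the de Bruijn graph *)

Lemma forallb_nth_eqb k u v :
  length u = k -> length v = k ->
  forallb (fun a => Bool.eqb (nth a u false) (nth a v false)) (seq 0 k)
  = if word_eq_dec v u then true else false.
Proof.
  intros Hu Hv. apply eq_true_iff_eq. rewrite forallb_forall.
  destruct (word_eq_dec v u) as [->|Hne]; split; intros H; try easy.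
  - intros a _. apply eqb_reflx.
  - exfalso. apply Hne. apply nth_ext with (d := false) (d' := false); [congruence|].
    intros i Hi. symmetry. apply eqb_prop, H, in_seq. lia.
Qed.

(** The free coordinate is 0, so this marginal is the inflow at the vertex [v]. The truncated
    [i - 1] is evaluated only at [i >= 1]. *)
Lemma marg_shifted_prefix k q v :
  length v = k ->
  marg k q (map (fun a => (a + 1)%nat) (seq 0 k)) (fun i => nth (i - 1) v false)
  = q (false :: v) + q (true :: v).
Proof.
  intros Hv. unfold marg, sumw. fold (sumL (words (S k))
    (fun w => if forallb (fun a => Bool.eqb (nth a w false) (nth (a - 1) v false))
      (map (fun a => (a + 1)%nat) (seq 0 k)) then q w else 0)).
  rewrite words_S. rewrite <- (sum_delta (words k) v (fun u => q (false :: u) + q (true :: u)));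
    [|apply NoDup_words|now apply in_words].
  apply sumL_ext. intros u Hu. apply in_words in Hu.
  assert (E : forall b, forallb (fun a => Bool.eqb (nth a (b :: u) false) (nth (a - 1) v false))
    (map (fun a => (a + 1)%nat) (seq 0 k)) = if word_eq_dec v u then true else false).
  { intros b. rewrite <- (forallb_nth_eqb k) by easy.
    induction (seq 0 k) as [|a l IH]; [reflexivity|]. cbn [map forallb]. rewrite IH.
    f_equal. rewrite Nat.add_sub, Nat.add_1_r. reflexivity. }
  rewrite !E. unfold delta. destruct (word_eq_dec v u); lra.
Qed.

Lemma marg_prefix k q v :
  length v = k ->
  marg k q (seq 0 k) (fun i => nth i v false) = q (v ++ [false]) + q (v ++ [true]).
Proof.
  intros Hv. unfold marg, sumw. fold (sumL (words (S k))
    (fun w => if forallb (fun a => Bool.eqb (nth a w false) (nth a v false))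
      (seq 0 k) then q w else 0)).
  rewrite words_snoc.
  rewrite <- (sum_delta (words k) v (fun u => q (u ++ [false]) + q (u ++ [true])));
    [|apply NoDup_words|now apply in_words].
  apply sumL_ext. intros u Hu. apply in_words in Hu.
  assert (E : forall b, forallb (fun a => Bool.eqb (nth a (u ++ [b]) false) (nth a v false))
    (seq 0 k) = if word_eq_dec v u then true else false).
  { intros b. rewrite <- (forallb_nth_eqb k) by easy.
    assert (Hlt : forall a, In a (seq 0 k) -> (a < length u)%nat).
    { intros a Ha. apply in_seq in Ha. lia. }
    induction (seq 0 k) as [|a l IH]; [reflexivity|]. cbn [forallb].
    rewrite IH, app_nth1 by auto using in_eq, in_cons. reflexivity. }
  rewrite !E. unfold delta. destruct (word_eq_dec v u); lra.
Qed.

(** Local translation invariance for the block [{0, ..., k-1}] and its translate by 1 is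
    conservation of flow at each vertex. *)
Lemma LTI_circulation k q : LTI k q -> circulation k q.
Proof.
  intros H v Hv. rewrite <- (marg_shifted_prefix k), <- (marg_prefix k) by easy.
  apply (H (seq 0 k) 1%nat (fun i => nth i v false)).
  intros a Ha. apply in_seq in Ha. lia.
Qed.

Definition vertex_cycle (k : nat) (o : orbit) : list (list bool) :=
  map (fun s => win (snd o) s k) (seq 0 (fst o)).

Lemma length_vertex_cycle k o : length (vertex_cycle k o) = fst o.
Proof. unfold vertex_cycle. now rewrite length_map, length_seq. Qed.

Lemma nth_vertex_cycle k o i :
  (i < fst o)%nat -> nth i (vertex_cycle k o) nil = win (snd o) i k.
Proof.
  intros Hi. rewrite nth_indep with (d' := win (snd o) 0 k)
    by now rewrite length_vertex_cycle.
  unfold vertex_cycle. rewrite (map_nth (fun s => win (snd o) s k)), seq_nth; easy.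
Qed.

Lemma vertex_cycle_is_cycle k o :
  (1 <= k)%nat -> simple k o -> is_cycle k (vertex_cycle k o).
Proof.
  intros Hk [Hp Hs]. split; [|split].
  - intros E. apply (f_equal (@length _)) in E. rewrite length_vertex_cycle in E.
    destruct Hp. cbn in E. lia.
  - apply NoDup_map_NoDup_ForallPairs; [|apply seq_NoDup].
    intros s t H1 H2. apply in_seq in H1, H2. apply Hs; lia.
  - intros i Hi. rewrite length_vertex_cycle in *.
    rewrite !nth_vertex_cycle by (trivial; apply Nat.mod_upper_bound; lia).
    rewrite win_mod by easy. split; [apply win_length|split; [apply win_length|]].
    destruct k as [|k]; [lia|].
    rewrite win_S_l, win_S_r, removelast_last. reflexivity.
Qed.

Lemma match_from_win x s w : match_from x s w = true <-> win x s (length w) = w.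
Proof.
  revert s. induction w as [|b w IH]; intros s; cbn [match_from length]; [easy|].
  rewrite win_S_l, andb_true_iff, IH, eqb_true_iff. split.
  - intros [-> ->]. reflexivity.
  - intros [= E1 E2]. now rewrite E1, E2.
Qed.

(** The first letters of the vertices spell the orbit again, vertices being nonempty for [k >= 1],
    so [nu] and [cnt] differ only by the normalization. *)
Lemma nu_vertex_cycle k o w :
  (1 <= k)%nat -> simple k o -> nu (vertex_cycle k o) w = / INR (fst o) * cnt o w.
Proof.
  intros Hk [Hp Hs]. unfold nu. rewrite length_vertex_cycle. f_equal. unfold cnt.
  assert (Hx : forall n, cycle_config (vertex_cycle k o) n = snd o n).
  { intros n. unfold cycle_config. rewrite length_vertex_cycle.
    rewrite nth_vertex_cycle by (apply Nat.mod_upper_bound; destruct Hp; lia).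
    rewrite win_mod by easy. destruct k; [lia|reflexivity]. }
  induction (seq 0 (fst o)) as [|s l IH]; [reflexivity|].
  rewrite sumL_cons, <- IH. cbn [filter].
  assert (E : win (cycle_config (vertex_cycle k o)) s (length w) = win (snd o) s (length w))
    by (apply win_ext; auto).
  destruct (match_from _ s w) eqn:Em.
  - apply match_from_win in Em. rewrite <- E, Em, delta_same. cbn [length].
    rewrite S_INR. lra.
  - rewrite delta_ne; [lra|]. intros E'. rewrite <- E in E'.
    apply match_from_win in E'. congruence.
Qed.

(** * Total entropy and assembly of the minimizer *)

Lemma sum_f_R0_sumL f n : sum_f_R0 f n = sumL (seq 0 (S n)) f.
Proof.
  induction n as [|n IH]; [cbn; lra|].
  rewrite seq_S, sumL_app, <- IH. cbn. lra.
Qed.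

(** The theorem asks for exactly [2^k + 1] terms, while the support may be smaller; the missing
    terms are filled with coefficient zero. *)
Lemma sum_padded {A : Type} (a0 : A) (f : A -> R) (l : list A) : forall n,
  (length l <= n)%nat ->
  sumL (seq 0 n) (fun j => if Nat.ltb j (length l) then f (nth j l a0) else 0) = sumL l f.
Proof.
  induction l as [|a l IH]; intros n Hn; [now apply sumL_zero|].
  destruct n as [|n]; [cbn in Hn; lia|]. cbn in Hn.
  cbn [seq]. rewrite !sumL_cons, <- seq_shift, sumL_map, <- (IH n) by lia. reflexivity.
Qed.

Lemma entropy_marg_eta P j :
  entropy_marg P j = sumL (words (S j)) (fun w => eta (P w)).
Proof.
  unfold entropy_marg, sumw. fold (sumL (words (S j)) (fun w => xlnx (P w))).
  unfold eta. rewrite (sumL_ext _ (fun w => - xlnx (P w)) (fun w => -1 * xlnx (P w)))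
    by (intros; lra).
  rewrite sumL_scal. lra.
Qed.

Lemma block_entropy_growing P n :
  TI P -> sumL (words n) (fun w => eta (P w)) <= sumL (words (S n)) (fun w => eta (P w)).
Proof.
  intros (_ & Hpos & Hr & _). rewrite words_snoc. apply sumL_le. intros w _.
  rewrite (Hr w). now apply eta_subadd.
Qed.

(** Appending a letter splits atoms, so block entropies grow with the length: bounded, they converge
    to a limit above them all; unbounded, they diverge. *)
Lemma total_entropy_exists P :
  TI P -> total_entropy_is P PInf \/
    exists e, total_entropy_is P (Fin e) /\
      forall n, sumL (words n) (fun w => eta (P w)) <= e.
Proof.
  intros HTI.
  assert (Hg : Un_growing (entropy_marg P)).
  { intros n. rewrite !entropy_marg_eta. now apply block_entropy_growing. }
  destruct (classic (has_ub (entropy_marg P))) as [Hub|Hub].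
  - right. destruct (growing_cv _ Hg Hub) as [e He]. exists e. split; [easy|].
    intros n. eapply Rle_trans; [now apply block_entropy_growing|].
    rewrite <- entropy_marg_eta. now apply growing_ineq.
  - left. intros B. apply NNPP. intros Hn. apply Hub. exists B. intros r [i ->].
    apply Rnot_lt_le. intros Hlt. apply Hn. exists i. intros n Hin.
    eapply Rlt_le_trans; [exact Hlt|]. apply Rge_le. now apply growing_prop.
Qed.

Theorem theorem5p2 (k : nat) (q : list bool -> R)
  (hk : (1 <= k)%nat) (hq : prob_Xk k q) (hLTI : LTI k q) :
  exists (c : nat -> R) (C : nat -> list (list bool)) (s : R),
    (forall i, (i <= Nat.pow 2 k)%nat -> 0 <= c i /\ is_cycle k (C i)) /\
    sum_f_R0 c (Nat.pow 2 k) = 1 /\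
    let Phat := fun w => sum_f_R0 (fun i => c i * nu (C i) w) (Nat.pow 2 k) in
    TI Phat /\ has_marginal k Phat q /\
    total_entropy_is Phat (Fin s) /\
    (forall P, TI P -> has_marginal k P q ->
       exists e, total_entropy_is P e /\ ER_le (Fin s) e).
Proof.
  destruct hq as [Hq0 Hq1]. fold (sumL (words (S k)) q) in Hq1.
  destruct (transversal_exists k) as (M & rep & Ht).
  assert (Hs := proj1 Ht).
  assert (Hper : forall i, (i < M)%nat -> periodic (rep i)) by (intros i Hi; apply (Hs i Hi)).
  assert (Hfeas : exists a, feasible k M rep q a).
  { destruct (circulation_decomposition k M rep (fun _ => True) Ht) with (F := q)
      as (a & Ha & Hd); auto.
    - now apply LTI_circulation.
    - exists a. split; [intros i Hi; now apply Ha|]. intros w Hw. now rewrite Hd. }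
  destruct (entropy_minimizer k M rep q Hper Hfeas) as (a & Ha & Hcard & Hmin).
  assert (Hmass : mass M rep a = 1).
  { rewrite <- (sum_combo M rep a (S k)), <- Hq1. apply sumL_ext.
    intros w Hw. apply Ha. now apply in_words. }
  (* Index 0 is the default of [nth] for padding terms, and these too must be cycles of [G_k]. *)
  assert (HM : (0 < M)%nat).
  { destruct M; [|lia]. cbn in Hmass. lra. }
  set (l := supp M a) in *.
  set (p := fun i => INR (fst (rep i))).
  assert (Hp : forall i, (i < M)%nat -> 0 < p i)
    by (intros i Hi; apply lt_0_INR; apply (Hper i Hi)).
  assert (Hl : forall i, In i l -> (i < M)%nat) by (intros i Hi; now apply in_supp in Hi).
  assert (Hnth : forall j, (nth j l 0 < M)%nat).
  { intros j. destruct (nth_in_or_default j l 0%nat) as [H| ->]; auto. }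
  (* The factor [p] turns a mass per point into the mass of the cycle, as [nu] is normalized. *)
  set (c := fun j => if Nat.ltb j (length l) then a (nth j l 0%nat) * p (nth j l 0%nat) else 0).
  set (C := fun j => vertex_cycle k (rep (nth j l 0%nat))).
  assert (Hcombo : forall w, sum_f_R0 (fun i => c i * nu (C i) w) (Nat.pow 2 k) = combo M rep a w).
  { intros w. rewrite sum_f_R0_sumL. unfold combo.
    rewrite (sum_supp M a) by (intros i ->; lra). fold l.
    rewrite <- (sum_padded 0%nat _ l (S (Nat.pow 2 k))) by easy.
    apply sumL_ext. intros j _. unfold c, C. destruct (Nat.ltb j (length l)); [|lra].
    rewrite nu_vertex_cycle by auto. fold (p (nth j l 0%nat)).
    field. apply Rgt_not_eq, Hp, Hnth. }
  assert (Hent : forall n, (2 * Nat.pow 2 k <= n)%nat ->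
    entropy_marg (fun w => sum_f_R0 (fun i => c i * nu (C i) w) (Nat.pow 2 k)) n
    = entropy_of M rep a).
  { intros n Hn. rewrite entropy_marg_eta, <- (entropy_of_combo k M rep a (S n)) by (trivial; lia).
    apply sumL_ext. intros w _. now rewrite Hcombo. }
  exists c, C, (entropy_of M rep a). split; [|split].
  - intros j _. split; [|apply vertex_cycle_is_cycle; auto].
    unfold c. destruct (Nat.ltb j (length l)); [|lra].
    apply Rmult_le_pos; [apply Ha, Hnth|apply pos_INR].
  - rewrite sum_f_R0_sumL. unfold c.
    rewrite (sum_padded 0%nat (fun i => a i * p i)) by easy.
    rewrite <- Hmass. symmetry. apply sum_supp. intros i ->. unfold p. lra.
  - intros Phat. split; [|split; [|split]].
    + unfold Phat. split; [|split; [|split]].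
      * now rewrite Hcombo, combo_nil.
      * intros w. rewrite Hcombo. apply sumL_nonneg. intros i Hi. apply in_seq in Hi.
        apply Rmult_le_pos; [apply Ha; lia|apply cnt_nonneg].
      * intros w. rewrite !Hcombo. apply combo_right.
      * intros w. rewrite !Hcombo. now apply combo_left.
    + intros w Hw. unfold Phat. rewrite Hcombo. now apply Ha.
    + intros eps Heps. exists (2 * Nat.pow 2 k)%nat. intros n Hn.
      unfold Phat. rewrite Hent by lia. unfold Rdist. rewrite Rminus_diag, Rabs_R0. lra.
    + intros P HTI Hmarg. destruct (total_entropy_exists P HTI) as [Hinf|(e & He & Hb)].
      * exists PInf. now split.
      * exists (Fin e). split; [easy|].
        apply (cycle_lower_bound k M rep P); auto.
        intros b [Hb0 Hb1]. apply Hmin. split; [easy|]. intros w Hw.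
        rewrite Hb1 by easy. now apply Hmarg.
Qed.
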